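(* Let the training set $\mathcal{S}$, the hypothesis class $\mathcal{H}^0$ (uncompressed neural networks), the loss $\ell$, the empirical risk $\hat{\mathcal L}$ and the true loss $\mathcal{L}$ be as in the context. Then for any $\delta\in(0,1)$ and $h\in\mathcal{H}^0$, with probability of at least $1-\delta$, $$\mathcal{L}(h)\leq \hat{\mathcal{L}}(h)+2^2\Big(\sqrt{2\ln(4\delta^{-1})}\,(B_{out}+B_{tgt})+2^6\cdot 3\sqrt{\omega_2/\omega_1}\,B_{out}\,\alpha^{-1} \big(1+c_0 B_{out}^{-1} n_c^{-\frac32}\big)^{\frac12}n_c^3 \Big)N^{-\frac12},$$ with the constant $c_0=2^5\pi^2 (|c_{\omega_1}|+|c_{\omega_2}|)(B_D^4+1)^\frac12 B_K^2 B_{in}$.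
   Context: Fixed: $0<\omega_1<\omega_2$ with $\omega_2/\omega_1\in\mathbb{N}$, $c_\omega=\frac{e^{i\pi/4}\omega^2}{\sqrt{8\pi\omega}}$, $\alpha>0$, positive integers with $n_c=n_\theta=\frac{\omega_1}{\omega_2}n_\rho$, and positive constants $B_{in},B_{tgt},B_{out},B_K,B_D$. $\|\cdot\|_F$ is the Frobenius norm, $\|\cdot\|_2$ the spectral norm, $A^*$ the conjugate transpose, $\mathrm{diag}(A)$ the row vector of diagonal entries of $A$. Matrices: $P_u=[I_{n_\theta}\;O_{n_\theta\times n_\theta}]$, $P_l=[O_{n_\theta\times n_\theta}\;I_{n_\theta}]$; $P_\omega\in\mathbb{R}^{n_\rho\times n_c}$ with $P_\omega[i,j]=1$ if $i=\frac{\omega}{\omega_1}j$ and $0$ otherwise. For $\Lambda=\begin{bmatrix}\Lambda^{\omega_1}\\\Lambda^{\omega_2}\end{bmatrix}\in\mathbb{C}^{2n_\theta\times n_\theta}$ and $1\le m\le n_\theta$, $R_m^{\omega}(\Lambda)=\Lambda^\omega_{\theta_m}\in\mathbb{C}^{n_\theta\times n_\theta}$, $\Lambda^\omega_{\theta_m}[i,j]=\Lambda^\omega[i+m,j+m]$ (indices mod $n_\theta$), $\omega\in\{\omega_1,\omega_2\}$. $\mathcal{H}^0_{BFNN}$ is the set of maps $\phi^0$ on $\mathbb{C}^{2n_\theta\times n_\theta}$, parametrized by $K\in\mathbb{C}^{n_\theta\times n_\rho}$ with $\|K\|_2\le B_K$ and $D\in\mathbb{C}^{n_\theta\times n_\theta}$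 with $\|D\|_2\le B_D$, given by $$\phi^0(\Lambda)=\sum_{i=1}^2 \Big(P_u^T \big(\phi_1^0 R_1^{\omega_i}(\Lambda),\cdots,\phi_1^0 R_{n_\theta}^{\omega_i}(\Lambda) \big)^T P_{\omega_i}+ P_l^T \big(\phi_2^0 R_1^{\omega_i}(\Lambda),\cdots,\phi_2^0 R_{n_\theta}^{\omega_i}(\Lambda)\big)^T P_{\omega_i}\Big),$$ where $(v_1,\dots,v_{n_\theta})^T$ is the matrix with $m$-th row $v_m$ and $$\phi_1^0\Lambda_{\theta_m}^\omega=-\frac{2\pi^2 c_{\omega}}{n_\theta^2}{\rm diag}\big(K^* ( D^*\Lambda_{\theta_m}^{\omega}D+D\Lambda_{\theta_m}^{\omega}D^* ) K\big),\quad \phi_2^0\Lambda_{\theta_m}^\omega=\frac{4\pi^2 c_{\omega}}{n_\theta^2}{\rm diag}\big(K^* \Lambda_{\theta_m}^{\omega} K\big).$$ $\mathcal{H}^0=\{h=\psi\circ\psi_0\circ\phi^0:\ \|\psi\|\le2\alpha^{-1},\ \|\psi_0\|\le2,\ \phi^0\in\mathcal{H}^0_{BFNN}\}$, where $\psi$ (convolutional part) and $\psi_0$ (change from polar to Cartesian coordinates) are linear operators on $2n_c\times n_c$ matrices and $\|\cdot\|$ is the operator norm with respect to $\|\cdot\|_F$. Data: $\mathcal{S}=\{(\Lambda_s,(\gamma_s,\eta_s)^T)\}_{s=1}^N$, with inputs $\Lambda_s\in\mathbb{C}^{2n_\theta\times n_\theta}$ and targets $(\gamma_s,\eta_s)^T\in\mathbb{R}^{2n_c\times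 n_c}$, drawn i.i.d. from a probability distribution $\mu=\mu_1\times\mu_2$, with $\|\Lambda_s\|_F\le B_{in}$ and $\|(\gamma_s,\eta_s)^T\|_F\le B_{tgt}$. It is assumed that the network outputs are real, $\phi^0(\Lambda_s)\in\mathbb{R}^{2n_c\times n_c}$, that $\|h(\Lambda_s)\|_F\le B_{out}$ for all $h\in\mathcal{H}^0$, and that $\|\phi^0(\Lambda_s)\|_F\le B_{out}$ for all $\phi^0\in\mathcal{H}^0_{BFNN}$. Loss: $\ell(h,\Lambda,(\gamma,\eta)^T)=\|h(\Lambda)-(\gamma,\eta)^T\|_F$; $\hat{\mathcal L}(h)=\frac1N\sum_{s=1}^N\ell(h,\Lambda_s,(\gamma_s,\eta_s)^T)$; $\mathcal{L}(h)=\mathbb{E}_{(\Lambda,(\gamma,\eta)^T)\sim\mu}[\ell(h,\Lambda,(\gamma,\eta)^T)]$. The probability is over the draw of $\mathcal{S}$. *)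

(* Defs.v *)
From HB Require Import structures.
From mathcomp Require Import all_boot all_order all_algebra.
From mathcomp Require Import complex.
From mathcomp Require Import all_classical all_reals all_analysis.

Set Implicit Arguments.
Unset Strict Implicit.
Unset Printing Implicit Defensive.

Import Order.TTheory GRing.Theory Num.Theory.
Import numFieldNormedType.Exports.

Local Open Scope classical_set_scope.
Local Open Scope ring_scope.
Local Open Scope complex_scope.

(* Throughout, n stands for the common value n_c = n_theta, and 2n is written
   n + n so that the block operations on matrices apply. *)

Section Norms.
Variable R : realType.

Definition frob m n (A : 'M[R[i]]_(m, n)) : R :=
  Num.sqrt (\sum_i \sum_j Normc.normc (A i j) ^+ 2).

(* Operator norm with respect to the Frobenius norms. *)
Definition opnorm m n p q (f : 'M[R[i]]_(m, n) -> 'M[R[i]]_(p, q)) : R :=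
  sup [set frob (f A) | A in [set A | frob A <= 1]].

(* The Frobenius norm of a column vector is its Euclidean norm. *)
Definition specnorm m n (A : 'M[R[i]]_(m, n)) : R :=
  opnorm (fun v : 'cV[R[i]]_n => A *m v).

Definition adjmx m n (A : 'M[R[i]]_(m, n)) : 'M[R[i]]_(n, m) :=
  map_mx (@conjc R) A^T.

Definition diagrow n (A : 'M[R[i]]_n) : 'rV[R[i]]_n := \row_j A j j.

Definition complexmx m n (A : 'M[R]_(m, n)) : 'M[R[i]]_(m, n) :=
  map_mx (real_complex R) A.

End Norms.

Section Measurability.
Variable R : realType.

HB.instance Definition _ := isPointed.Build R[i] 0.

(* The sigma-algebras generated by the (real and imaginary parts of the)
   entries, i.e. the Borel sigma-algebras of these finite-dimensional spaces. *)
Definition cmx_gen m n : set (set 'M[R[i]]_(m, n)) :=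
  [set A | exists i j, exists2 B : set R, measurable B &
     A = [set L : 'M[R[i]]_(m, n) | B (complex.Re (L i j))] \/
     A = [set L : 'M[R[i]]_(m, n) | B (complex.Im (L i j))]].

Definition rmx_gen m n : set (set 'M[R]_(m, n)) :=
  [set A | exists i j, exists2 B : set R, measurable B &
     A = [set L : 'M[R]_(m, n) | B (L i j)]].

Definition cmx_meas m n := g_sigma_algebraType (@cmx_gen m n).
Definition rmx_meas m n := g_sigma_algebraType (@rmx_gen m n).

HB.instance Definition _ m n := Measurable.on (cmx_meas m n).
HB.instance Definition _ m n := Measurable.on (rmx_meas m n).

End Measurability.

Section Network.
Variables (R : realType) (omega1 omega2 : R) (n nrho : nat).

Definition c_omega (omega : R) : R[i] :=
  (cos (pi / 4) +i* sin (pi / 4)) *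
  (omega ^+ 2 / Num.sqrt (8 * pi * omega))%:C.

Definition P_u : 'M[R[i]]_(n, n + n) := row_mx 1%:M 0.
Definition P_l : 'M[R[i]]_(n, n + n) := row_mx 0 1%:M.

(* P_omega [i, j] = 1 iff i = (omega / omega1) j for indices starting at 1,
   hence the successors. *)
Definition P_omega (omega : R) : 'M[R[i]]_(nrho, n) :=
  \matrix_(i, j) (i.+1%:R == omega / omega1 * j.+1%:R :> R)%:R.

Fact cshift_subproof (i : 'I_n) (m : nat) : ((i + m) %% n < n)%N.
Proof. by rewrite ltn_pmod // (leq_ltn_trans _ (ltn_ord i)). Qed.

Definition cshift (m : nat) (i : 'I_n) : 'I_n := Ordinal (cshift_subproof i m).

Definition rotmx (m : nat) (A : 'M[R[i]]_n) : 'M[R[i]]_n :=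
  \matrix_(i, j) A (cshift m i) (cshift m j).

Definition phi1 (K : 'M[R[i]]_(n, nrho)) (D : 'M[R[i]]_n) (omega : R)
    (A : 'M[R[i]]_n) : 'rV[R[i]]_nrho :=
  (- ((2 * pi ^+ 2 / n%:R ^+ 2)%:C * c_omega omega)) *:
  diagrow (adjmx K *m (adjmx D *m A *m D + D *m A *m adjmx D) *m K).

Definition phi2 (K : 'M[R[i]]_(n, nrho)) (omega : R)
    (A : 'M[R[i]]_n) : 'rV[R[i]]_nrho :=
  ((4 * pi ^+ 2 / n%:R ^+ 2)%:C * c_omega omega) *:
  diagrow (adjmx K *m A *m K).

(* Contribution of one frequency; A is the block Lambda^omega.  The row of
   index m : 'I_n is the m.+1-st row, computed from R_{m+1}^omega(Lambda). *)
Definition phi0_freq (K : 'M[R[i]]_(n, nrho)) (D : 'M[R[i]]_n) (omega : R)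
    (A : 'M[R[i]]_n) : 'M[R[i]]_(n + n, n) :=
  P_u^T *m (\matrix_(m < n) phi1 K D omega (rotmx m.+1 A)) *m P_omega omega +
  P_l^T *m (\matrix_(m < n) phi2 K omega (rotmx m.+1 A)) *m P_omega omega.

Definition phi0 (K : 'M[R[i]]_(n, nrho)) (D : 'M[R[i]]_n)
    (Lambda : 'M[R[i]]_(n + n, n)) : 'M[R[i]]_(n + n, n) :=
  phi0_freq K D omega1 (usubmx Lambda) + phi0_freq K D omega2 (dsubmx Lambda).

Definition H0_BFNN (B_K B_D : R) :
    set ('M[R[i]]_(n + n, n) -> 'M[R[i]]_(n + n, n)) :=
  [set phi | exists K D, [/\ specnorm K <= B_K, specnorm D <= B_D &
                             phi = phi0 K D]].

Definition H0 (alpha B_K B_D : R) :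
    set ('M[R[i]]_(n + n, n) -> 'M[R[i]]_(n + n, n)) :=
  [set h | exists (psi psi0 : {linear 'M[R[i]]_(n + n, n) ->
                                      'M[R[i]]_(n + n, n)}) phi,
     [/\ opnorm psi <= 2 * alpha^-1, opnorm psi0 <= 2,
         H0_BFNN B_K B_D phi & h = psi \o psi0 \o phi]].

End Network.

Section Risks.
Variables (R : realType) (n : nat).
Implicit Type h : 'M[R[i]]_(n + n, n) -> 'M[R[i]]_(n + n, n).

Definition data := (cmx_meas R (n + n) n * rmx_meas R (n + n) n)%type.

HB.instance Definition _ := Measurable.on data.

Definition loss h (z : data) : R := frob (h z.1 - complexmx z.2).

Definition true_risk (mu : set data -> \bar R) h : \bar R :=
  (\int[mu]_z (loss h z)%:E)%E.

Definition empirical_risk N h (S : 'I_N -> data) : R :=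
  N%:R^-1 * \sum_(s < N) loss h (S s).

End Risks.

Definition iid_with_law d d' (Omega : measurableType d) (T : measurableType d')
    (R : realType) (P : probability Omega R) (mu : set T -> \bar R) (N : nat)
    (X : 'I_N -> {RV P >-> T}) : Prop :=
  (forall s (A : set T), measurable A -> P (X s @^-1` A) = mu A) /\
  (forall A : 'I_N -> set T, (forall s, measurable (A s)) ->
     P [set w | forall s, A s (X s w)] = (\prod_(s < N) P (X s @^-1` A s))%E).

(* Main.v *)
Require Import Defs.
From HB Require Import structures.
From mathcomp Require Import all_boot all_order all_algebra.
From mathcomp Require Import complex.
From mathcomp Require Import all_classical all_reals all_analysis.
From mathcomp Require Import perm measurable_realfun.
From mathcomp Require Import ring lra.

Set Implicit Arguments.
Unset Strict Implicit.
Unset Printing Implicit Defensive.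

Import Order.TTheory GRing.Theory Num.Theory.
Import numFieldNormedType.Exports.

Local Open Scope classical_set_scope.
Local Open Scope ring_scope.

(* A map of H0 is complex linear in Lambda, and on almost every input it is
   bounded by B = min (B_out, 4 B_out / alpha).  So it is enough to control,
   uniformly, the linear maps bounded by B on the set X of admissible inputs.
   Maximising a determinant gives a spanning family x_1, ..., x_r of X, with
   r <= 2 n^2, such that every x in X is a combination of the x_i with
   coefficients at most 2; hence rounding the entries of the h x_i yields nets
   for the norm sup_X |h x|, of logarithmic size O(n^4 (n + k)) at scale
   B / 8^k.  Losses are 1-Lipschitz for this norm, so Hoeffding's inequality
   along the links of a chain of such nets starting at h = 0 bounds the
   generalization gap.  As the logarithmic sizes are at most n^6 (11 + 3 k)^2,
   the sum over scales is of order n^3 B; of the factors sqrt (omega2 / omega1)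
   and sqrt (1 + c0 ...), only the lower bound 1 matters. *)

(** * Hoeffding's inequality *)

(* On [-1, 1] this reduces to a polynomial inequality through
   [expR (- x) >= (1 - x / 4) ^+ 4] and [expR (x ^+ 2) >= (1 + x ^+ 2 / 2) ^+ 2]. *)
Lemma expR_le_addr_expR_sqr (R : realType) (x : R) :
  expR x <= x + expR (x ^+ 2).
Proof.
have [x1|x1] := leP 1 x.
  have : expR x <= expR (x ^+ 2) by rewrite ler_expR; nra.
  by lra.
have [xN1|xN1] := leP x (-1).
  have /andP[] : (expR x <= 1) && (1 + x ^+ 2 <= expR (x ^+ 2)).
    by rewrite expR_le1 expR_ge1Dx andbT; lra.
  by nra.
have e4 : (1 - x / 4) ^+ 4 <= expR (- x).
  have -> : - x = 4%:R * (- (x / 4)) by lra.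
  rewrite expRM_natl lerXn2r ?nnegrE ?expR_ge0//; first by lra.
  exact: expR_ge1Dx.
have e2 : (1 + x ^+ 2 / 2) ^+ 2 <= expR (x ^+ 2).
  have -> : expR (x ^+ 2) = expR (2%:R * (x ^+ 2 / 2)) by congr expR; lra.
  rewrite expRM_natl lerXn2r ?nnegrE ?expR_ge0 ?expR_ge1Dx//.
  by rewrite addr_ge0// divr_ge0// sqr_ge0.
have pol : 1 <= (x + (1 + x ^+ 2 / 2) ^+ 2) * (1 - x / 4) ^+ 4.
  (* In terms of [y], right side minus left side is [y ^ 2 * ((1 - 4 y) * p1 + y ^ 4 * p2)], where
     [p1] and [p2] are the polynomials shown nonnegative in [q1] and [q2]. *)
  pose y := x / 4; have xy : x = 4 * y by rewrite /y; lra.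
  have y1 : 4 * y < 1 by lra.
  have yN1 : -1 < 4 * y by lra.
  rewrite -/y xy.
  have y2 := sqr_ge0 y.
  have q1 : 0 <= 6 - 20 * y + 65 * y ^+ 2 - 56 * y ^+ 3.
    have y14 : 0 <= 1 - 4 * y by lra.
    by have := mulr_ge0 y2 y14; have := sqr_ge0 (1 - 5 * y); lra.
  have q2 : 0 <= 176 - 256 * y + 64 * y ^+ 2 by lra.
  have q3 : 0 <= 1 - 4 * y by lra.
  have := mulr_ge0 y2 (addr_ge0 (mulr_ge0 q3 q1) (mulr_ge0 (mulr_ge0 y2 y2) q2)).
  by rewrite -subr_ge0; congr (_ <= _); field.
have sum_ge0 : 0 <= x + (1 + x ^+ 2 / 2) ^+ 2 by nra.
have le1 : 1 <= (x + expR (x ^+ 2)) * expR (- x).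
  apply: le_trans pol _; apply: ler_pM => //; last by lra.
  by rewrite exprn_ge0//; lra.
have -> : x + expR (x ^+ 2) = (x + expR (x ^+ 2)) * expR (- x) * expR x.
  by rewrite -mulrA -expRD addNr expR0 mulr1.
by rewrite ler_peMl ?expR_ge0.
Qed.

(** Apply [expR_le_addr_expR_sqr] at [l * v i]: the linear term averages to zero because [v] is
    centred. The exponent is twice the sharp one, which only affects constants. *)
Lemma mgf_le_expR (R : realType) (I : finType) (p v : I -> R) (c l : R) :
  (forall i, 0 <= p i) -> \sum_i p i = 1 -> \sum_i p i * v i = 0 ->
  (forall i, `|v i| <= c) ->
  \sum_i p i * expR (l * v i) <= expR (l ^+ 2 * c ^+ 2).
Proof.
move=> p0 p1 pv0 vc.
have -> : expR (l ^+ 2 * c ^+ 2) =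
    \sum_i p i * (l * v i + expR (l ^+ 2 * c ^+ 2)).
  under eq_bigr do rewrite mulrDr mulrCA.
  by rewrite big_split/= -mulr_sumr pv0 mulr0 add0r -mulr_suml p1 mul1r.
apply: ler_sum => i _; apply: ler_wpM2l => //.
apply: le_trans (expR_le_addr_expR_sqr _) _.
rewrite lerD2l ler_expR exprMn ler_wpM2l ?sqr_ge0//.
by rewrite -real_normK ?num_real// lerXn2r ?nnegrE// (le_trans _ (vc i)).
Qed.

(* The left-hand side is the probability that an i.i.d. sample [s] from [p]
   has a small sum. *)
Lemma finite_hoeffding (R : realType) (I : finType) (N : nat) (p v : I -> R)
    (m c t : R) :
  0 < c -> 0 <= t ->
  (forall i, 0 <= p i) -> \sum_i p i = 1 -> \sum_i p i * v i = m ->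
  (forall i, `|v i - m| <= c) ->
  \sum_(s : {ffun 'I_N -> I} | \sum_k v (s k) <= N%:R * (m - t))
     \prod_k p (s k) <= expR (- (N%:R * t ^+ 2 / (4 * c ^+ 2))).
Proof.
move=> c0 t0 p0 p1 pv vc.
(* This [l] minimises [l ^ 2 c ^ 2 - l t], with minimum [- t ^ 2 / (4 c ^ 2)]. *)
pose l := t / (2 * c ^+ 2).
have l0 : 0 <= l by rewrite divr_ge0// mulr_ge0// sqr_ge0.
(* Chernoff: on the event, the product of the exponential weights is at least 1; off it, the terms
   are nonnegative. *)
apply: (@le_trans _ _ (\sum_(s : {ffun 'I_N -> I})
    \prod_k (p (s k) * expR (l * (m - v (s k)) - l * t)))).
  rewrite [leLHS]big_mkcond/=; apply: ler_sum => s _.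
  have pr0 : 0 <= \prod_k p (s k) by rewrite prodr_ge0.
  rewrite big_split/= -expR_sum; case: ifPn => [le_s|_].
    rewrite ler_peMr// -expR0 ler_expR sumrB -mulr_sumr sumrB.
    rewrite !sumr_const card_ord -(mulr_natl (l * t)) -(mulr_natl m).
    rewrite [X in _ - X]mulrCA -mulrBr mulr_ge0//; lra.
  by rewrite mulr_ge0// expR_ge0.
(* Independence: the sum over samples factors into the [N]-th power of a sum over one coordinate. *)
rewrite -(@bigA_distr_bigA _ _ _ _ _ _ _
  (fun (k : 'I_N) j => p j * expR (l * (m - v j) - l * t))) prodr_const card_ord.
have -> : - (N%:R * t ^+ 2 / (4 * c ^+ 2)) =
    N%:R * (l ^+ 2 * c ^+ 2 - l * t).
  by rewrite /l; field; rewrite gt_eqF.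
rewrite expRM_natl lerXn2r ?nnegrE ?expR_ge0//.
  by rewrite sumr_ge0// => i _; rewrite mulr_ge0 ?expR_ge0.
rewrite expRB.
under eq_bigr do rewrite expRB mulrA.
rewrite -mulr_suml ler_wpM2r ?invr_ge0 ?expR_ge0//.
apply: mgf_le_expR => //.
  under eq_bigr do rewrite mulrBr.
  by rewrite sumrB pv -mulr_suml p1 mul1r subrr.
by move=> i; rewrite distrC.
Qed.

(** * Events indexed by a finite type, and the union bound *)

Section FiniteFamilies.
Context d (T : measurableType d) (I : finType).

Lemma measurable_forall_fin (F : I -> set T) :
  (forall i, measurable (F i)) -> measurable [set w | forall i, F i w].
Proof.
move=> mF; rewrite (_ : [set w | _] = \bigcap_(i in setT) F i); last first.
  by apply/seteqP; split=> w /= Fw i; [move=> _|]; exact: Fw.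
by apply: fin_bigcap_measurable => // i _; exact: mF.
Qed.

Lemma exists_fin_bigsetU (Q : pred I) (F : I -> set T) :
  [set w | exists2 i, Q i & F i w] = \big[setU/set0]_(i | Q i) F i.
Proof. by rewrite -bigcup_pred. Qed.

Lemma measurable_exists_fin (Q : pred I) (F : I -> set T) :
  (forall i, measurable (F i)) ->
  measurable [set w | exists2 i, Q i & F i w].
Proof.
by move=> mF; rewrite exists_fin_bigsetU; apply: bigsetU_measurable => i _.
Qed.

Lemma measure_exists_fin_le (R : realFieldType) (mu : {measure set T -> \bar R})
    (Q : pred I) (F : I -> set T) :
  (forall i, measurable (F i)) ->
  (mu [set w | exists2 i, Q i & F i w] <= \sum_(i | Q i) mu (F i))%E.
Proof.
move=> mF; rewrite exists_fin_bigsetU.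
suff [] : measurable (\big[setU/set0]_(i | Q i) F i) /\
  (mu (\big[setU/set0]_(i | Q i) F i) <= \sum_(i | Q i) mu (F i))%E by [].
apply: (big_rec2 (fun A x => measurable A /\ (mu A <= x)%E)).
  by rewrite measure0.
move=> i A x _ [mA Ax]; split; first exact: measurableU.
by apply: le_trans (measureU2 _ _ _) _ => //; rewrite leeD2l.
Qed.

End FiniteFamilies.

(** The total mass of [mu] is read off from the law of the first sample point, hence the condition
    on [N]. *)
Lemma iid_law_setT d d' (Omega : measurableType d) (T : measurableType d')
    (R : realType) (P : probability Omega R) (mu : set T -> \bar R) (N : nat)
    (X : 'I_N -> {RV P >-> T}) :
  (0 < N)%N -> iid_with_law mu X -> mu setT = 1%E.
Proof.
move=> N0 [law _]; rewrite -(law (Ordinal N0) setT measurableT).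
by rewrite preimage_setT probability_setT.
Qed.

Section Hoeffding.
Context d d' (Omega : measurableType d) (T : measurableType d').
Context (R : realType) (P : probability Omega R) (mu : {measure set T -> \bar R}).
Context (N : nat) (X : 'I_N -> {RV P >-> T}).
Hypotheses (N0 : (0 < N)%N) (iidX : iid_with_law mu X).

Section FiniteValued.
Context (M : nat) (code : T -> nat).
Hypothesis codeM : forall z, (code z < M)%N.
Hypothesis mcode : forall j, measurable [set z | code z = j].

Let p (j : 'I_M) : R := fine (mu [set z | code z = j]).

Lemma fine_measure_fiber (j : 'I_M) :
  mu [set z | code z = j] = (fine (mu [set z | code z = j]))%:E.
Proof.
rewrite fineK// ge0_fin_numE// (@le_lt_trans _ _ 1%E) ?ltry//.
by rewrite -(iid_law_setT N0 iidX) le_measure ?inE//; exact: measurableT.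
Qed.

Let p_ge0 j : 0 <= p j. Proof. by rewrite /p fine_ge0. Qed.

Lemma sum_measure_fiber : \sum_(j < M) fine (mu [set z | code z = j]) = 1.
Proof.
apply: EFin_inj; rewrite -sumEFin -(iid_law_setT N0 iidX).
under eq_bigr do rewrite -fine_measure_fiber.
rewrite -(measure_bigsetU mu (F := fun j => [set z | code z = j]))//.
  congr (mu _); rewrite -(bigcup_mkord M (fun j => [set z | code z = j])).
  by apply/seteqP; split => // z _; exists (code z) => //=; exact: codeM.
by apply/trivIsetP => i j _ _ /eqP ij; apply/seteqP; split => // z [/= -> ].
Qed.

(** A function of the code has a finite law, given by the masses of the fibres; independence turns
    the probability of a sequence of codes into a product, and [finite_hoeffding] applies. *)
Lemma hoeffding_finite_valued (v : 'I_M -> R) (c t : R) :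
  0 < c -> 0 <= t -> (forall i j, `|v i - v j| <= c) ->
  (P [set w | (\sum_s v (Ordinal (codeM (X s w))) <=
       N%:R * (\sum_(j < M) fine (mu [set z | code z = j]) * v j - t))%R]
   <= (expR (- (N%:R * t ^+ 2 / (4 * c ^+ 2))))%:E)%E.
Proof.
move=> c0 t0 vc; pose m := \sum_j p j * v j; rewrite -/m.
have vm i : `|v i - m| <= c.
  have -> : v i - m = \sum_j p j * (v i - v j).
    under [RHS]eq_bigr do rewrite mulrBr.
    by rewrite sumrB -mulr_suml sum_measure_fiber mul1r.
  apply: le_trans (ler_norm_sum _ _ _) _.
  rewrite -[leRHS]mul1r -sum_measure_fiber mulr_suml; apply: ler_sum => j _.
  by rewrite normrM ger0_norm ?fine_ge0// ler_wpM2l// fine_ge0.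
have := finite_hoeffding N c0 t0 p_ge0 sum_measure_fiber (erefl m) vm.
rewrite -lee_fin; apply: le_trans.
(* The events [G f] split [Omega] according to the sequence of codes of the sample. *)
pose G (f : {ffun 'I_N -> 'I_M}) := [set w | forall s, code (X s w) = f s].
have mG f : measurable (G f).
  apply: (measurable_forall_fin (F := fun s => X s @^-1` [set z | code z = f s])).
  by move=> s; exact: measurable_funPTI.
have PG f : P (G f) = (\prod_s p (f s))%:E.
  have := iidX.2 (fun s => [set z | code z = f s]) (fun s => mcode (f s)).
  rewrite -prodEFin => -> //; apply: eq_bigr => s _.
  by rewrite iidX.1// fine_measure_fiber.
rewrite -sumEFin; under eq_bigr do rewrite -PG.
apply: le_trans (measure_exists_fin_le _ _ mG).
apply: le_measure; rewrite ?inE.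
- rewrite (_ : [set w | _] = [set w | exists2 f : {ffun 'I_N -> 'I_M},
    \sum_s v (f s) <= N%:R * (m - t) & G f w]); last first.
    apply/seteqP; split => w /=.
      move=> le_w; exists [ffun s => Ordinal (codeM (X s w))].
        by under eq_bigr do rewrite ffunE.
      by move=> s; rewrite ffunE.
    move=> [f le_f Gfw]; congr (_ <= _): le_f; apply: eq_bigr => s _; congr v.
    by apply: val_inj; rewrite /= Gfw.
  exact: measurable_exists_fin.
- exact: measurable_exists_fin.
- move=> w /= le_w; exists [ffun s => Ordinal (codeM (X s w))].
    by under eq_bigr do rewrite ffunE.
  by move=> s; rewrite ffunE.
Qed.

End FiniteValued.
End Hoeffding.

Lemma measurable_sample_sum_le d d' (Omega : measurableType d)
    (T : measurableType d') (R : realType) (P : probability Omega R) (N : nat)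
    (X : 'I_N -> {RV P >-> T}) (g : T -> R) (a : R) :
  measurable_fun setT g -> measurable [set w | \sum_s g (X s w) <= a].
Proof.
move=> mg.
rewrite (_ : [set w | _] = setT `&` (fun w => \sum_s g (X s w)) @^-1` `]-oo, a]).
  apply: measurable_sum => //.
  by move=> s; apply: (measurableT_comp mg); exact: measurable_funPT.
by rewrite setTI; apply/seteqP; split => w /=; rewrite in_itv.
Qed.


(* Rounding [f] to one of its values in each cell of length [e] keeps the range
   and moves [f] by at most [e]. *)
Lemma hoeffding_rounded d d' (Omega : measurableType d) (T : measurableType d')
    (R : realType) (P : probability Omega R) (mu : {measure set T -> \bar R})
    (N : nat) (X : 'I_N -> {RV P >-> T}) (f : T -> R) (z0 : T) (m c t e : R) :
  (0 < N)%N -> iid_with_law mu X ->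
  measurable_fun setT f -> (forall z, 0 <= f z <= c) ->
  (\int[mu]_z (f z)%:E = m%:E)%E ->
  0 < c -> 0 < e -> 2 * e <= t ->
  (P [set w | (\sum_s f (X s w) <= N%:R * (m - t))%R]
   <= (expR (- (N%:R * (t - 2 * e) ^+ 2 / (4 * c ^+ 2))))%:E)%E.
Proof.
move=> N0 iidX mf f0c fm c0 e0 et.
pose code z := Num.truncn (f z / e).
pose M := (Num.truncn (c / e)).+1.
have fe0 z : 0 <= f z / e by rewrite divr_ge0 ?(ltW e0)//; case/andP: (f0c z).
have codeM z : (code z < M)%N.
  by rewrite ltnS le_truncn// ler_pM2r ?invr_gt0//; case/andP: (f0c z).
have codeP z j : code z = j <-> j%:R * e <= f z < j.+1%:R * e.
  rewrite -ler_pdivlMr// -ltr_pdivrMr// -truncn_eq//.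
  by rewrite /code; split=> /eqP.
have mcode j : measurable [set z | code z = j].
  rewrite (_ : [set z | _] = setT `&` f @^-1` `[j%:R * e, j.+1%:R * e[).
    by apply: mf.
  rewrite setTI; apply/seteqP; split => z /=; rewrite in_itv/=.
    exact: (codeP z j).1.
  exact: (codeP z j).2.
(* An empty cell receives the value [f z0], which also lies in [[0, c]], so the range bound [vc]
   holds for all cells. *)
pose v (j : 'I_M) := f (xget z0 [set z | code z = j]).
have fv z : `|f z - v (Ordinal (codeM z))| <= e.
  rewrite /v/=; case: xgetP => [y -> /= cy|/(_ z) []//].
  have /codeP/andP[y1 y2] := cy; have /codeP/andP[z1 z2] := erefl (code z).
  by move: y1 y2 z1 z2; rewrite -!natr1 ler_distl; lra.
have vc i j : `|v i - v j| <= c.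
  rewrite /v; have := f0c (xget z0 [set z | code z = i]).
  by have := f0c (xget z0 [set z | code z = j]); rewrite ler_distl; lra.
(* First loss of [e], on the mean: [f] lies below the step function equal to [v j + e] on cell
   [j]. *)
have mE : m <= \sum_(j < M) fine (mu [set z | code z = j]) * v j + e.
  rewrite -[e]mul1r -(sum_measure_fiber N0 iidX codeM mcode) mulr_suml -big_split/=.
  rewrite -lee_fin -fm -sumEFin.
  have v0 j : 0 <= v j + e.
    by rewrite addr_ge0 ?(ltW e0)// /v; case/andP: (f0c (xget z0 [set z | code z = j])).
  apply: (@le_trans _ _ (\int[mu]_z \sum_(j < M)
      ((v j + e)%:E * (\1_[set z | code z = j] z)%:E))%E).
    apply: ge0_le_integral => //.
    - by move=> z _; rewrite lee_fin; case/andP: (f0c z).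
    - exact/measurable_EFinP.
    - apply: emeasurable_sum => j; apply: measurable_funeM.
      by apply/measurable_EFinP; exact: measurable_indic.
    - move=> z _; rewrite (bigD1 (Ordinal (codeM z)))//= big1; last first.
        move=> j; rewrite -val_eqE/= => jz.
        rewrite indicE memNset ?mule0//=; apply/eqP; by rewrite eq_sym.
      rewrite adde0 indicE mem_set//= mule1 lee_fin.
      by have := fv z; rewrite ler_distl; lra.
  rewrite ge0_integral_sum//; last 2 first.
  - move=> j; apply: measurable_funeM.
    by apply/measurable_EFinP; exact: measurable_indic.
  - by move=> j z _; rewrite mule_ge0// lee_fin.
  apply: lee_sum => j _; rewrite ge0_integralZl//; last 2 first.
  - by apply/measurable_EFinP; exact: measurable_indic.
  - by rewrite lee_fin.
  rewrite integral_indic// setIT (fine_measure_fiber N0 iidX mcode) -EFinM lee_fin.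
  by rewrite -mulrDr mulrC.
apply: le_trans (hoeffding_finite_valued N0 iidX codeM mcode (v := v) c0 _ vc);
  last by lra.
apply: le_measure; rewrite ?inE.
- exact: measurable_sample_sum_le.
- apply: (@measurable_sample_sum_le _ _ _ _ _ _ _ X
    (fun z => v (Ordinal (codeM z)))) => _ B _.
  rewrite setTI (_ : _ @^-1` B =
    [set z | exists2 j : 'I_M, true & code z = j /\ B (v j)]).
    apply: measurable_exists_fin => j.
    have [Bj|Bj] := pselect (B (v j)).
      rewrite [X in measurable X](_ : _ = [set z | code z = j])//.
      by apply/seteqP; split => z; [case|].
    by rewrite [X in measurable X](_ : _ = set0)//; apply/seteqP; split => z [].
  apply/seteqP; split => z /=; first by exists (Ordinal (codeM z)).
  move=> [j _ [zj Bj]]; rewrite (_ : Ordinal _ = j)//; exact: val_inj.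
(* Second loss of [e], on the sample sum; together they turn [t] into [t - 2 * e]. *)
- move=> w /= le_w.
  have : \sum_s v (Ordinal (codeM (X s w))) <= \sum_s (f (X s w) + e).
    by apply: ler_sum => s _; have := fv (X s w); rewrite ler_distl; lra.
  move=> /le_trans; apply; rewrite big_split/= sumr_const card_ord -mulr_natl.
  have : N%:R * m <= N%:R * (\sum_(j < M) fine (mu [set z | code z = j]) * v j + e).
    by rewrite ler_wpM2l.
  move: le_w; rewrite !mulrBr !mulrDr; lra.
Qed.

Lemma integrable_of_bounded d (T : measurableType d) (R : realType)
    (mu : {measure set T -> \bar R}) (f : T -> R) (b : R) :
  (mu setT < +oo)%E -> measurable_fun setT f -> (forall z, `|f z| <= b) ->
  mu.-integrable setT (EFin \o f).
Proof.
move=> muT mf fb; apply: measurable_bounded_integrable => //.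
exists b; split; first by rewrite num_real.
by move=> B ltB z _ /=; rewrite (le_trans (fb z))// ltW.
Qed.

(** The cell length in [hoeffding_rounded] is arbitrary, so its effect on the exponent vanishes in
    the limit. *)
Lemma hoeffding_pos d d' (Omega : measurableType d) (T : measurableType d')
    (R : realType) (P : probability Omega R) (mu : {measure set T -> \bar R})
    (N : nat) (X : 'I_N -> {RV P >-> T}) (f : T -> R) (z0 : T) (m c t : R) :
  (0 < N)%N -> iid_with_law mu X ->
  measurable_fun setT f -> (forall z, 0 <= f z <= c) ->
  (\int[mu]_z (f z)%:E = m%:E)%E -> 0 < c -> 0 <= t ->
  (P [set w | (\sum_s f (X s w) <= N%:R * (m - t))%R]
   <= (expR (- (N%:R * t ^+ 2 / (4 * c ^+ 2))))%:E)%E.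
Proof.
move=> N0 iidX mf f0c fm c0; rewrite le_eqVlt => /predU1P[<-|t0].
  rewrite expr0n/= mulr0 mul0r oppr0 expR0; apply: probability_le1.
  exact: measurable_sample_sum_le.
set B := [set w | _]; set g0 := expR _.
have mB : measurable B by exact: measurable_sample_sum_le.
have PB : P B = (fine (P B))%:E by rewrite fineK// fin_num_measure.
have x1 : fine (P B) <= 1.
  by rewrite -lee_fin -PB probability_le1.
rewrite PB lee_fin; apply/ler_addgt0Pr => y y0.
pose k := N%:R * t / c ^+ 2.
have k0 : 0 < k by rewrite divr_gt0 ?exprn_gt0// mulr_gt0// ltr0n.
(* [k * e] is the first-order change of the exponent when [t] becomes [t - 2 * e]; it is kept below
   [y]. *)
pose e := Num.min (t / 2) (y / k).
have e0 : 0 < e by rewrite lt_min divr_gt0//= divr_gt0.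
have et : 2 * e <= t by rewrite mulrC -ler_pdivlMr// ge_min lexx.
have ke : k * e <= y by rewrite mulrC -ler_pdivlMr// ge_min lexx orbT.
have xg : fine (P B) <= g0 * expR y.
  rewrite -lee_fin -PB; apply: le_trans.
    exact: (hoeffding_rounded z0 N0 iidX mf f0c fm c0 e0 et).
  rewrite lee_fin -expRD ler_expR.
  have -> : - (N%:R * (t - 2 * e) ^+ 2 / (4 * c ^+ 2)) =
    - (N%:R * t ^+ 2 / (4 * c ^+ 2)) + k * e - N%:R * e ^+ 2 / c ^+ 2.
    by rewrite /k; field; rewrite gt_eqF.
  rewrite -addrA lerD2l lerBlDr (le_trans ke)// lerDl.
  by rewrite divr_ge0 ?sqr_ge0// mulr_ge0 ?sqr_ge0.
have g00 : 0 < g0 by exact: expR_gt0.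
(* Since [expR (- y) >= 1 - y] and the probability is at most 1, this yields the additive bound
   [g0 + y]. *)
have : fine (P B) * expR (- y) <= g0.
  by rewrite expRN ler_pdivrMr ?expR_gt0.
have := expR_ge1Dx (- y); have : 0 <= fine (P B) by exact: fine_ge0.
nra.
Qed.

(* The exponent [-L] corresponds to the deviation [2 * c * sqrt (L / N)]. *)
Lemma hoeffding d d' (Omega : measurableType d) (T : measurableType d')
    (R : realType) (P : probability Omega R) (mu : {measure set T -> \bar R})
    (N : nat) (X : 'I_N -> {RV P >-> T}) (f : T -> R) (z0 : T) (m a c L : R) :
  (0 < N)%N -> iid_with_law mu X ->
  measurable_fun setT f -> (forall z, a <= f z <= a + c) ->
  (\int[mu]_z (f z)%:E = m%:E)%E -> 0 < c -> 0 <= L ->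
  (P [set w | (N%:R^-1 * (\sum_s f (X s w)) + 2 * c * Num.sqrt (L / N%:R) <= m)%R]
   <= (expR (- L))%:E)%E.
Proof.
move=> N0 iidX mf fac fm c0 L0.
have N0R : (0 : R) < N%:R by rewrite ltr0n.
have LN : 0 <= L / N%:R by rewrite divr_ge0.
have muT := iid_law_setT N0 iidX.
have mfa : measurable_fun setT (fun z => f z - a).
  by apply: measurable_funB => //; exact: measurable_cst.
have intf : mu.-integrable setT (EFin \o f).
  apply: (@integrable_of_bounded _ _ _ _ _ (`|a| + c)) => //.
    by rewrite muT ltry.
  move=> z; have := fac z; have := ler_norm a; have := ler_norm (- a).
  by rewrite normrN ler_norml; lra.
have inta : mu.-integrable setT (EFin \o cst a).
  apply: (@integrable_of_bounded _ _ _ _ _ `|a|) => //.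
  by rewrite muT ltry.
have fa_int : (\int[mu]_z (f z - a)%:E = (m - a)%:E)%E.
  have -> : (\int[mu]_z (f z - a)%:E = \int[mu]_z (f z)%:E - \int[mu]_z (cst a z)%:E)%E.
    by rewrite -integralB_EFin.
  by rewrite fm (integral_cst mu measurableT a%:E) muT mule1.
have fac' z : 0 <= f z - a <= c by have := fac z; lra.
pose t := 2 * c * Num.sqrt (L / N%:R).
have t0 : 0 <= t by rewrite !mulr_ge0 ?sqrtr_ge0 ?(ltW c0).
have := hoeffding_pos z0 N0 iidX mfa fac' fa_int c0 t0.
have -> : N%:R * t ^+ 2 / (4 * c ^+ 2) = L.
  rewrite /t !exprMn sqr_sqrtr//; field.
  by rewrite !gt_eqF.
have E u : (N%:R^-1 * u + t <= m) = (u - N%:R * a <= N%:R * (m - a - t)).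
  by rewrite -lerBrDr ler_pdivrMl// lerBlDr; congr (_ <= _); ring.
have sumE w : \sum_s (f (X s w) - a) = \sum_s f (X s w) - N%:R * a.
  by rewrite sumrB sumr_const card_ord -(mulr_natl a).
by congr (P _ <= _)%E; apply/seteqP; split => w; rewrite /= sumE E.
Qed.

(** * Chaining *)

Definition sample_mean d (Omega : measurableType d) (T : Type) (R : realType)
    (N : nat) (X : 'I_N -> Omega -> T) (f : T -> R) (w : Omega) : R :=
  N%:R^-1 * \sum_s f (X s w).

Section Chaining.
Context d d' (Omega : measurableType d) (T : measurableType d').
Context (R : realType) (P : probability Omega R) (mu : {measure set T -> \bar R}).
Context (N : nat) (X : 'I_N -> {RV P >-> T}) (z0 : T).
Hypotheses (N0 : (0 < N)%N) (iidX : iid_with_law mu X).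

Let mean (f : T -> R) : R := fine (\int[mu]_z (f z)%:E).

Let mu_fin : (mu setT < +oo)%E.
Proof. by rewrite (iid_law_setT N0 iidX) ltry. Qed.

Let bounded_fun (f : T -> R) := exists b, forall z, `|f z| <= b.

Let intf f : measurable_fun setT f -> bounded_fun f ->
  mu.-integrable setT (EFin \o f).
Proof. by move=> mf [b fb]; exact: integrable_of_bounded fb. Qed.

Let meanE f : measurable_fun setT f -> bounded_fun f ->
  (\int[mu]_z (f z)%:E = (mean f)%:E)%E.
Proof.
by move=> mf bf; rewrite fineK//; apply: integrable_fin_num => //; exact: intf.
Qed.

Let meanB f g : measurable_fun setT f -> bounded_fun f ->
  measurable_fun setT g -> bounded_fun g ->
  mean (fun z => f z - g z) = mean f - mean g.
Proof.
move=> mf bf mg bg; apply: EFin_inj; rewrite -meanE; first last.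
- have [[b fb] [b' gb]] := (bf, bg); exists (b + b') => z.
  by apply: le_trans (ler_normB _ _) _; exact: lerD.
- exact: measurable_funB.
rewrite EFinB -!meanE// -integralB_EFin//; exact: intf.
Qed.

Let mean_le f c : measurable_fun setT f -> bounded_fun f ->
  (forall z, `|f z| <= c) -> mean f <= c.
Proof.
move=> mf bf fc; rewrite -lee_fin -meanE//.
have muT := iid_law_setT N0 iidX.
have -> : c%:E = (\int[mu]_z (cst c z)%:E)%E.
  by rewrite (integral_cst mu measurableT c%:E) muT mule1.
apply: le_integral => //; first exact: intf.
  by apply: (@integrable_of_bounded _ _ _ _ _ `|c|).
by move=> z _; rewrite lee_fin (le_trans (ler_norm _)).
Qed.

Let deviation f t := [set w | sample_mean X f w + t <= mean f].

Let mdeviation f t : measurable_fun setT f -> measurable (deviation f t).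
Proof.
move=> mf; rewrite (_ : deviation f t =
  [set w | \sum_s f (X s w) <= N%:R * (mean f - t)]).
  exact: measurable_sample_sum_le.
apply/seteqP; split => w; rewrite /deviation/= /sample_mean -lerBrDr;
  by rewrite ler_pdivrMl// ltr0n.
Qed.

Let sample_meanB (f g : T -> R) w :
  sample_mean X (fun z => f z - g z) w = sample_mean X f w - sample_mean X g w.
Proof. by rewrite /sample_mean sumrB mulrBr. Qed.

Let sample_mean_le (f : T -> R) c w : (forall z, `|f z| <= c) -> sample_mean X f w <= c.
Proof.
move=> fc; rewrite /sample_mean ler_pdivrMl ?ltr0n//.
rewrite mulr_natl -[X in _ *+ X]card_ord -sumr_const; apply: ler_sum => s _.
exact: le_trans (ler_norm _) (fc _).
Qed.

Variables (I : Type) (G H : set I) (l : I -> T -> R) (h0 : I).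
(* [rep k (code k h)] is the point of the net of level [k] approximating [h]. *)
Variables (F : nat -> finType) (code : forall k, I -> F k) (rep : forall k, F k -> I).
Variables (b delta W : R) (eps lam : nat -> R).
Arguments code : clear implicits.
Arguments rep : clear implicits.
Hypotheses (lG : forall i, G i -> measurable_fun setT (l i))
  (bG : forall i, G i -> bounded_fun (l i))
  (HG : H `<=` G) (Gh0 : G h0) (Grep : forall k c, G (rep k c))
  (rep0 : forall c, rep 0%N c = h0)
  (b0 : 0 < b) (lh0 : forall z, 0 <= l h0 z <= b)
  (repP : forall k h, H h -> forall z, `|l h z - l (rep k (code k h)) z| <= eps k)
  (eps0 : forall k, 0 < eps k) (lam0 : forall k, 0 <= lam k)
  (delta0 : 0 <= delta)
  (lam0_delta : expR (- lam 0%N) <= delta / (2 ^ 1)%:R)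
  (lam_delta : forall k, #|F k|%:R * #|F k.+1|%:R * expR (- lam k.+1) <=
     delta / (2 ^ k.+2)%:R)
  (W_ge : forall K, 2 * b * Num.sqrt (lam 0%N / N%:R) + \sum_(k < K)
     2 * (2 * (eps k + eps k.+1)) * Num.sqrt (lam k.+1 / N%:R) <= W)
  (eps_small : forall e, 0 < e -> exists K, eps K <= e).

Let link k (p : F k * F k.+1) z := l (rep k.+1 p.2) z - l (rep k p.1) z.

(** Only these pairs have increments small enough for Hoeffding at scale [eps k]; each pair of codes
    of one [h] in [H] is among them. *)
Let close k (p : F k * F k.+1) : bool :=
  `[< forall z, `|link p z| <= eps k + eps k.+1 >].

(** Level 0 concerns the starting point [h0] alone; level [j + 1] concerns all links between the
    nets of levels [j] and [j + 1]. *)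
Let bad k : set Omega := if k is j.+1 then
    [set w | exists2 p : F j * F j.+1, close p & deviation (link p)
       (2 * (2 * (eps j + eps j.+1)) * Num.sqrt (lam j.+1 / N%:R)) w]
  else deviation (l h0) (2 * b * Num.sqrt (lam 0%N / N%:R)).

Let mlink k (p : F k * F k.+1) : measurable_fun setT (link p).
Proof. by apply: measurable_funB; exact: lG. Qed.

Let mbad k : measurable (bad k).
Proof.
case: k => [|k] /=; first by apply: mdeviation; exact: lG.
by apply: measurable_exists_fin => p; exact: mdeviation.
Qed.

(** Hoeffding for each link, whose values range over an interval of length [2 * (eps k + eps k.+1)],
    then the union bound over the pairs, paid for by [lam_delta]. *)
Let Pbad k : (P (bad k) <= (delta / (2 ^ k.+1)%:R)%:E)%E.
Proof.
case: k => [|k] /=.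
  apply: le_trans (_ : (expR (- lam 0%N))%:E <= _)%E; last by rewrite lee_fin.
  apply: (hoeffding z0 N0 iidX (lG Gh0) (a := 0)) => //.
    by move=> z; rewrite add0r.
  by apply: meanE; [exact: lG|exact: bG].
apply: le_trans (measure_exists_fin_le _ _ _) _.
  by move=> p; exact: mdeviation.
apply: (@le_trans _ _ (\sum_(p : F k * F k.+1) (expR (- lam k.+1))%:E)%E).
  rewrite big_mkcond/=; apply: lee_sum => p _; case: ifPn => [/asboolP cp|_]; last first.
    by rewrite lee_fin expR_ge0.
  have e0 : 0 < eps k + eps k.+1 by rewrite addr_gt0.
  apply: (hoeffding z0 N0 iidX (mlink p) (a := - (eps k + eps k.+1))) => //.
  - by move=> z; have := cp z; rewrite ler_norml; lra.
  - by apply: meanE => //; eexists; exact: cp.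
  - by rewrite mulr_gt0.
rewrite sumEFin sumr_const card_prod lee_fin -(mulr_natl (expR _)) natrM.
exact: lam_delta.
Qed.

(** Off all bad events, the deviation of [l h] is controlled by summing along the chain from [h0]
    through the approximations of [h]. The event is chosen before [h], so the bound is uniform. *)
Lemma chaining : exists E : set Omega, [/\ measurable E,
  ((1 - delta)%:E <= P E)%E &
  forall w, E w -> forall h, H h ->
    (\int[mu]_z (l h z)%:E <= (sample_mean X (l h) w + W)%:E)%E].
Proof.
exists (~` \bigcup_k bad k); split.
- by apply: measurableC; exact: bigcup_measurable.
- rewrite probability_setC; last exact: bigcup_measurable.
  rewrite EFinB leeB//.
  apply: le_trans (measure_sigma_subadditive _ mbad (bigcup_measurable _)
    (@subset_refl _ _)) _ => //.
  (* The bounds [delta / 2 ^ (k + 1)] sum to [delta]. *)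
  apply: le_trans (epsilon_trick0 xpredT delta0).
  by apply: lee_nneseries => // k _; exact: Pbad.
move=> w nbad h Hh.
rewrite meanE; [rewrite lee_fin|by apply: lG; exact: HG|by apply: bG; exact: HG].
have good k : ~ bad k w by move=> bk; apply: nbad; exists k.
pose pi k := rep k (code k h).
(* Telescoping: the chain starts at [h0] by [rep0], and each good link adds its own deviation
   term. *)
have pi_le K : mean (l (pi K)) <= sample_mean X (l (pi K)) w +
    (2 * b * Num.sqrt (lam 0%N / N%:R) + \sum_(k < K)
     2 * (2 * (eps k + eps k.+1)) * Num.sqrt (lam k.+1 / N%:R)).
  elim: K => [|K IH].
    rewrite big_ord0 addr0 /pi rep0.
    by have /negP := good 0%N; rewrite -ltNge => /ltW.
  have cp : close (code K h, code K.+1 h).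
    apply/asboolP => z; rewrite /link/=.
    by have := repP K Hh z; have := repP K.+1 Hh z; rewrite !ler_norml; lra.
  have : ~~ (sample_mean X (link (code K h, code K.+1 h)) w +
      2 * (2 * (eps K + eps K.+1)) * Num.sqrt (lam K.+1 / N%:R) <=
      mean (link (code K h, code K.+1 h))).
    by apply/negP => dev; apply: (good K.+1); exists (code K h, code K.+1 h).
  rewrite -ltNge sample_meanB meanB; [|exact: lG|exact: bG|exact: lG|exact: bG].
  by rewrite big_ord_recr/=; rewrite -/(pi K) -/(pi K.+1); lra.
apply/ler_addgt0Pr => e e0.
(* Replacing [h] by [pi K] costs [eps K] twice, once in the mean and once in the sample mean; hence
   [e / 2]. *)
have [K eK] := eps_small (divr_gt0 e0 (ltr0Sn R 1)).
have mp : mean (l h) - mean (l (pi K)) <= eps K.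
  rewrite -meanB; [|by apply: lG; exact: HG|by apply: bG; exact: HG
                   |exact/lG/Grep|exact/bG/Grep].
  apply: mean_le; last exact: repP.
    by apply: measurable_funB; apply: lG; [exact: HG|exact: Grep].
  by exists (eps K); exact: repP.
have sp : sample_mean X (l (pi K)) w - sample_mean X (l h) w <= eps K.
  rewrite -sample_meanB; apply: sample_mean_le => z; rewrite distrC; exact: repP.
have := pi_le K; have := W_ge K; lra.
Qed.
End Chaining.

(** * Bounded spanning families and nets of linear maps *)

Section ComplexNorm.
Variable R : realType.
Implicit Types x y : R[i].
Local Notation normc := (@Normc.normc R).

Lemma normc_normE x : `|x| = (normc x)%:C%C.
Proof. by case: x. Qed.

Lemma normc_ge0 x : 0 <= normc x.
Proof. by case: x => a b; exact: sqrtr_ge0. Qed.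

Lemma ler_normcD x y : normc (x + y) <= normc x + normc y.
Proof. by have := ler_normD x y; rewrite !normc_normE -rmorphD/= lecR. Qed.

Lemma normcN x : normc (- x) = normc x.
Proof. by case: x => a b; rewrite /Normc.normc/= !sqrrN. Qed.

Lemma sqr_normc x : normc x ^+ 2 = complex.Re x ^+ 2 + complex.Im x ^+ 2.
Proof. by case: x => a b; rewrite sqr_sqrtr// addr_ge0 ?sqr_ge0. Qed.

Lemma ler_normc_sum (I : Type) (r : seq I) (Q : pred I) (F : I -> R[i]) :
  normc (\sum_(i <- r | Q i) F i) <= \sum_(i <- r | Q i) normc (F i).
Proof.
apply: (big_ind2 (fun u v => normc u <= v)) => [|x a y b xa yb|//].
  by rewrite Normc.normc0.
by apply: le_trans (ler_normcD _ _) _; exact: lerD.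
Qed.

Lemma normc_prod (I : Type) (r : seq I) (Q : pred I) (F : I -> R[i]) :
  normc (\prod_(i <- r | Q i) F i) = \prod_(i <- r | Q i) normc (F i).
Proof.
by apply: (big_morph normc); [exact: Normc.normcM|exact: Normc.normc1].
Qed.

(** Leibniz expansion. This crude bound serves to make the supremum of minors in [exists_spanner]
    finite. *)
Lemma normc_det_le n (A : 'M[R[i]]_n) (B : R) :
  (forall i j, normc (A i j) <= B) -> normc (\det A) <= n`!%:R * B ^+ n.
Proof.
move=> AB; apply: le_trans (ler_normc_sum _ _ _) _.
apply: (@le_trans _ _ (\sum_(s : 'S_n) B ^+ n)).
  apply: ler_sum => s _; rewrite Normc.normcM.
  have -> : normc ((-1) ^+ s) = 1.
    by case: (odd_perm s); rewrite ?expr1 ?expr0 ?normcN Normc.normc1.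
  rewrite mul1r normc_prod -[X in B ^+ X]card_ord -prodr_const.
  by apply: ler_prod => i _; rewrite normc_ge0 AB.
by rewrite sumr_const mulr_natl card_Sn.
Qed.

End ComplexNorm.

Section Spanner.
Variables (R : realType) (p : nat) (X : set 'rV[R[i]]_p) (B : R).
Local Notation normc := (@Normc.normc R).
Hypothesis Xbounded : forall x, X x -> forall j, normc (x 0 j) <= B.

(** Take a free family in [X] of maximal size: appending a vector of [X] outside its row space would
    keep it free. *)
Lemma exists_max_rank : exists r (A : 'M[R[i]]_(r, p)),
  [/\ row_free A, forall i, X (row i A) & forall x, X x -> (x <= A)%MS].
Proof.
pose Q r := `[< exists A : 'M[R[i]]_(r, p), row_free A /\ forall i, X (row i A) >].
have Q0 : exists r, Q r.
  exists 0%N; apply/asboolP; exists (0 : 'M[R[i]]_(0, p)); split; last by case.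
  by rewrite /row_free mxrank0.
have Qp r : Q r -> (r <= p)%N.
  by move=> /asboolP[A [fA _]]; rewrite -(eqP fA) rank_leq_col.
case: (ex_maxnP Q0 Qp) => r /asboolP[A [fA XA]] rmax; exists r, A; split=> // x Xx.
apply/negPn/negP => nxA; suff : Q (1 + r)%N by move/rmax; rewrite ltnn.
apply/asboolP; exists (col_mx x A); split.
  have : (\rank A < \rank (col_mx x A))%N; last first.
    by rewrite (eqP fA) /row_free eqn_leq rank_leq_row.
  apply: rank_ltmx.
  rewrite /ltmx; apply/andP; split; first by rewrite -addsmxE addsmxSr.
  by rewrite -addsmxE addsmx_sub submx_refl andbT.
move=> i; case: (split_ordP i) => j ->.
  by rewrite rowKu (_ : row j x = x)// row_id.
by rewrite rowKd.
Qed.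

(* Auerbach-type basis: the rows of a nearly determinant-maximal matrix; the
   coefficients are bounded by 2 by Cramer's rule. *)
Lemma exists_spanner : exists r (A : 'M[R[i]]_(r, p)),
  [/\ (r <= p)%N, forall i, X (row i A) & forall x, X x -> exists2 c : 'rV[R[i]]_r,
     x = c *m A & forall i, normc (c 0 i) <= 2].
Proof.
have [r [A0 [fA0 XA0 spanA0]]] := exists_max_rank.
have rp : (r <= p)%N by rewrite -(eqP fA0) rank_leq_col.
have fullA0 : row_full A0^T by rewrite /row_full mxrank_tr.
(* [f] selects [r] columns on which [A0] has a nonzero minor; all determinants below use these
   columns. *)
pose f := fullrankfun fullA0.
pose minor (A : 'M[R[i]]_(r, p)) : R[i] := \det (colsub f A).
have minor0 : minor A0 != 0.
  rewrite /minor -det_tr trmx_mxsub -unitfE -unitmxE.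
  exact: fullrowsub_unit.
pose D := [set normc (minor A) | A in [set A | forall i, X (row i A)]].
have D0 : D (normc (minor A0)) by exists A0.
have Dub : has_ubound D.
  exists (r`!%:R * B ^+ r) => _ [A XA <-]; apply: normc_det_le => i j.
  by rewrite mxE; have := Xbounded (XA i) (f j); rewrite !mxE.
have hsD : has_sup D by split; [exists (normc (minor A0))|].
have n0 : 0 < normc (minor A0).
  rewrite lt_neqAle normc_ge0 andbT eq_sym.
  by apply: contra_neq minor0; exact: Normc.eq0_normc.
have s0 : 0 < sup D by apply: lt_le_trans n0 _; exact: ub_le_sup.
have s20 : 0 < sup D / 2 by rewrite divr_gt0.
(* The supremum need not be attained; a minor above half of it is what gives coefficients at most
   2. *)
have [_ [A XA <-] ltA] := sup_adherent s20 hsD.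
have nA : 0 < normc (minor A) by lra.
have minorA : minor A != 0.
  by apply: contra_ltN nA => /eqP ->; rewrite Normc.normc0.
have rankA : \rank A = r.
  apply/eqP; rewrite eqn_leq rank_leq_row /=.
  have rkf : \rank (colsub f A) = r by apply: mxrank_unit; rewrite unitmxE unitfE.
  have : (\rank (colsub f A) <= \rank A)%N; last by rewrite rkf.
  by rewrite -(mxrank_tr A) -mxrank_tr trmx_mxsub mxrankS// rowsub_sub.
have AA0 : (A <= A0)%MS by apply/row_subP => i; exact: spanA0.
have A0A : (A0 <= A)%MS.
  have := mxrank_leqif_eq AA0; rewrite rankA (eqP fA0) => -[_].
  by rewrite eqxx => /esym/andP[].
exists r, A; split=> // x Xx.
have [c xc] := submxP (submx_trans (spanA0 _ Xx) A0A).
(* Cramer's rule: replacing row [i] of [A] by [x] multiplies the minor by [c 0 i], and the new rows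
   are still in [X]. *)
exists c => // i; pose A' := \matrix_(k < r) if k == i then x else row k A.
have XA' k : X (row k A') by rewrite rowK; case: eqP.
have minorA' : minor A' = c 0 i * minor A.
  rewrite /minor (expand_det_row _ i).
  transitivity ((c *m (colsub f A *m \adj (colsub f A))) 0 i); last first.
    by rewrite mul_mx_adj mul_mx_scalar mxE mulrC.
  rewrite mulmxA mxE; apply: eq_bigr => j _; congr (_ * _).
    by rewrite !mxE eqxx xc mxE; apply: eq_bigr => k _; rewrite mxE.
  rewrite mxE /cofactor; congr (_ * \det _); apply/matrixP => k l.
  by rewrite !mxE (negbTE (_ : lift i k != i)) ?mxE// eq_sym neq_lift.
have : normc (minor A') <= sup D by apply: ub_le_sup => //; exists A'.
by rewrite minorA' Normc.normcM => le1; rewrite -(ler_pM2r nA); lra.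
Qed.
End Spanner.

(** Minkowski's inequality, from [(a + b) ^ 2 <= (s + t) (a ^ 2 / s + b ^ 2 / t)] with [s] and [t]
    the two norms, enlarged by [e / 2] to be positive. *)
Lemma sqrt_sum_sqrD_le (R : realType) (I : finType) (a b : I -> R) :
  Num.sqrt (\sum_i (a i + b i) ^+ 2) <=
  Num.sqrt (\sum_i a i ^+ 2) + Num.sqrt (\sum_i b i ^+ 2).
Proof.
set A := \sum_i a i ^+ 2; set B := \sum_i b i ^+ 2.
have A0 : 0 <= A by apply: sumr_ge0 => i _; exact: sqr_ge0.
have B0 : 0 <= B by apply: sumr_ge0 => i _; exact: sqr_ge0.
apply/ler_addgt0Pr => e e0.
pose s := Num.sqrt A + e / 2; pose t := Num.sqrt B + e / 2.
have sA0 := sqrtr_ge0 A; have sB0 := sqrtr_ge0 B.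
have s0 : 0 < s by rewrite /s; lra.
have t0 : 0 < t by rewrite /t; lra.
have -> : Num.sqrt A + Num.sqrt B + e = s + t by rewrite /s /t; lra.
have st0 : 0 <= s + t by rewrite addr_ge0 ?ltW.
rewrite -(ger0_norm st0) -sqrtr_sqr ler_wsqrtr//.
apply: (@le_trans _ _ (\sum_i ((s + t) * (a i ^+ 2 / s + b i ^+ 2 / t)))).
  apply: ler_sum => i _; rewrite -subr_ge0.
  have -> : (s + t) * (a i ^+ 2 / s + b i ^+ 2 / t) - (a i + b i) ^+ 2 =
      (t * a i - s * b i) ^+ 2 / (s * t).
    by field; rewrite !gt_eqF.
  by rewrite divr_ge0 ?sqr_ge0// mulr_ge0// ltW.
rewrite -mulr_sumr expr2 ler_wpM2l// big_split/= -!mulr_suml; apply: lerD.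
  rewrite ler_pdivrMr// -[leLHS]sqr_sqrtr// expr2.
  by rewrite ler_pM// /s; lra.
rewrite ler_pdivrMr// -[leLHS]sqr_sqrtr// expr2.
by rewrite ler_pM// /t; lra.
Qed.

(** * Frobenius and operator norms *)

Section Frobenius.
Variable R : realType.
Local Notation normc := (@Normc.normc R).

Lemma frob_ge0 m n (A : 'M[R[i]]_(m, n)) : 0 <= frob A.
Proof. exact: sqrtr_ge0. Qed.

Lemma frob0 m n : frob (0 : 'M[R[i]]_(m, n)) = 0.
Proof.
rewrite /frob big1 ?sqrtr0// => i _; rewrite big1// => j _.
by rewrite mxE Normc.normc0 expr0n.
Qed.

Lemma frobZ m n c (A : 'M[R[i]]_(m, n)) : frob (c *: A) = normc c * frob A.
Proof.
rewrite /frob -(ger0_norm (normc_ge0 c)) -sqrtr_sqr -sqrtrM ?sqr_ge0//.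
congr Num.sqrt; rewrite mulr_sumr; apply: eq_bigr => i _.
rewrite mulr_sumr; apply: eq_bigr => j _.
by rewrite mxE Normc.normcM exprMn.
Qed.

Lemma frobN m n (A : 'M[R[i]]_(m, n)) : frob (- A) = frob A.
Proof. by rewrite -scaleN1r frobZ normcN Normc.normc1 mul1r. Qed.

Lemma frobD m n (A B : 'M[R[i]]_(m, n)) : frob (A + B) <= frob A + frob B.
Proof.
rewrite /frob !pair_bigA/=.
apply: le_trans (sqrt_sum_sqrD_le _ _); apply: ler_wsqrtr.
apply: ler_sum => p _; rewrite lerXn2r ?nnegrE ?addr_ge0 ?normc_ge0//.
by rewrite mxE ler_normcD.
Qed.

Lemma frob_sum m n (I : Type) (r : seq I) (F : I -> 'M[R[i]]_(m, n)) :
  frob (\sum_(i <- r) F i) <= \sum_(i <- r) frob (F i).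
Proof.
apply: (big_ind2 (fun A x => frob A <= x)) => [|A x B y Ax By|//].
  by rewrite frob0.
by apply: le_trans (frobD _ _) _; exact: lerD.
Qed.

Lemma normc_le_frob m n (A : 'M[R[i]]_(m, n)) i j : normc (A i j) <= frob A.
Proof.
rewrite -(ger0_norm (normc_ge0 _)) -sqrtr_sqr ler_wsqrtr//.
rewrite (bigD1 i)//= (bigD1 j)//= -addrA lerDl addr_ge0//.
  by apply: sumr_ge0 => k _; exact: sqr_ge0.
by apply: sumr_ge0 => k _; apply: sumr_ge0 => l _; exact: sqr_ge0.
Qed.

Lemma frob_eq0 m n (A : 'M[R[i]]_(m, n)) : frob A = 0 -> A = 0.
Proof.
move=> A0; apply/matrixP => i j; rewrite mxE; apply: Normc.eq0_normc.
by apply/eqP; rewrite eq_le normc_ge0 andbT -A0 normc_le_frob.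
Qed.

Lemma abs_Re_le_normc (x : R[i]) : `|complex.Re x| <= normc x.
Proof.
rewrite -(ger0_norm (normc_ge0 x)) -ler_sqr ?nnegrE// -!normrX !ger0_norm ?sqr_ge0//.
by rewrite sqr_normc lerDl sqr_ge0.
Qed.

Lemma abs_Im_le_normc (x : R[i]) : `|complex.Im x| <= normc x.
Proof.
rewrite -(ger0_norm (normc_ge0 x)) -ler_sqr ?nnegrE// -!normrX !ger0_norm ?sqr_ge0//.
by rewrite sqr_normc lerDr sqr_ge0.
Qed.

Lemma frob_le_parts m n (A : 'M[R[i]]_(m, n)) e :
  0 <= e ->
  (forall i j, `|complex.Re (A i j)| <= e /\ `|complex.Im (A i j)| <= e) ->
  frob A <= Num.sqrt (2 * m * n)%:R * e.
Proof.
move=> e0 Ae.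
rewrite -[X in _ * X](ger0_norm e0) -sqrtr_sqr -sqrtrM// ler_wsqrtr//.
apply: (@le_trans _ _ (\sum_(i < m) \sum_(j < n) (2 * e ^+ 2))).
  apply: ler_sum => i _; apply: ler_sum => j _; have [ReA ImA] := Ae i j.
  rewrite sqr_normc.
  have : complex.Re (A i j) ^+ 2 <= e ^+ 2.
    by rewrite -real_normK ?num_real// lerXn2r ?nnegrE.
  have : complex.Im (A i j) ^+ 2 <= e ^+ 2.
    by rewrite -real_normK ?num_real// lerXn2r ?nnegrE.
  lra.
rewrite !sumr_const !card_ord -mulrnA -(mulr_natl (2 * _)) mulrA -natrM.
by rewrite mulnC (mulnC n) mulnA.
Qed.

(** Expand along the matrix units. The bound ensures that [opnorm] of a linear map is the supremum
    of a bounded set. *)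
Lemma linear_frob_bound m n p q (f : {linear 'M[R[i]]_(m, n) -> 'M[R[i]]_(p, q)}) :
  exists2 c, 0 <= c & forall A, frob (f A) <= c * frob A.
Proof.
exists (\sum_i \sum_j frob (f (delta_mx i j))).
  by apply: sumr_ge0 => i _; apply: sumr_ge0 => j _; exact: frob_ge0.
move=> A; rewrite {1}(matrix_sum_delta A) linear_sum.
apply: le_trans (frob_sum _ _) _; rewrite mulr_suml; apply: ler_sum => i _.
rewrite linear_sum; apply: le_trans (frob_sum _ _) _.
rewrite mulr_suml; apply: ler_sum => j _.
by rewrite linearZ/= frobZ mulrC ler_wpM2l ?frob_ge0// normc_le_frob.
Qed.

Lemma frob_le_opnorm m n p q (f : {linear 'M[R[i]]_(m, n) -> 'M[R[i]]_(p, q)}) A :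
  frob (f A) <= opnorm f * frob A.
Proof.
have [c c0 fc] := linear_frob_bound f.
have [/eqP A0|A0] := boolP (frob A == 0).
  by rewrite (frob_eq0 A0) linear0 !frob0 mulr0.
have nA : 0 < frob A by rewrite lt_neqAle eq_sym A0 frob_ge0.
have nE : normc (frob A)^-1%:C%C = (frob A)^-1.
  by rewrite /Normc.normc/= expr0n/= addr0 sqrtr_sqr ger0_norm// invr_ge0 frob_ge0.
rewrite -ler_pdivrMr// mulrC -{1}nE -frobZ -linearZ/=.
apply: ub_le_sup.
  exists c => _ [B /= B1 <-]; apply: le_trans (fc B) _.
  by rewrite -[leRHS]mulr1 ler_wpM2l.
by exists ((frob A)^-1%:C%C *: A) => //=; rewrite frobZ nE mulVf.
Qed.

End Frobenius.

Section Nets.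
Variables (R : realType) (m n p q : nat).
Local Notation normc := (@Normc.normc R).
Implicit Type h : 'M[R[i]]_(m, n) -> 'M[R[i]]_(p, q).

(** Cells of length [B / M] in [[-B, B]]; the last of the [2 * M + 1] codes is reached only at
    [t = B]. Only arguments in [[-B, B]] are compared. *)
Definition round_code (B : R) (M : nat) (t : R) : 'I_(2 * M).+1 :=
  inord (Num.truncn ((t + B) / B * M%:R)).

Lemma eq_round_code (B : R) (M : nat) (t u : R) : 0 < B -> (0 < M)%N ->
  `|t| <= B -> `|u| <= B -> round_code B M t = round_code B M u ->
  `|t - u| <= B / M%:R.
Proof.
move=> B0 M0; rewrite !ler_norml => tB uB /(congr1 val).
have M0R : (0 : R) < M%:R by rewrite ltr0n.
have range s : - B <= s <= B -> 0 <= (s + B) / B * M%:R <= (2 * M)%:R.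
  move=> sB; have s0 : 0 <= s + B by lra.
  apply/andP; split; first by rewrite mulr_ge0// divr_ge0// ltW.
  by rewrite natrM ler_pM2r// ler_pdivrMr//; lra.
have trunc_le s : - B <= s <= B ->
    (Num.truncn ((s + B) / B * M%:R) < (2 * M).+1)%N.
  by move=> /range/andP[s0 s1]; rewrite ltnS -(ler_nat R) (le_trans _ s1)// truncn_le.
rewrite /= !inordK ?trunc_le// => tu.
have /andP[/truncn_itv/andP[]] := range _ tB.
have /andP[/truncn_itv/andP[]] := range _ uB.
rewrite tu -!natr1; set k := _%:R => u1 u2 _ t1 t2 _.
have : `|(t + B) / B * M%:R - (u + B) / B * M%:R| <= 1 by rewrite ler_norml; lra.
have -> : (t + B) / B * M%:R - (u + B) / B * M%:R = (t - u) * (M%:R / B).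
  by field; rewrite gt_eqF.
have MB : 0 < M%:R / B by rewrite divr_gt0.
by rewrite normrM (gtr0_norm MB) -ler_pdivlMr// div1r invf_div ler_norml.
Qed.

Variables (X : set 'M[R[i]]_(m, n)) (bx B : R).
Hypotheses (Xbounded : forall x, X x -> frob x <= bx) (B0 : 0 < B).

(* A linear map is determined on [X] by the entries of its values on a bounded
   spanning family of [X]; rounding these entries gives the net. *)
Lemma linear_net : exists2 r, (r <= m * n)%N & forall M, (0 < M)%N ->
  exists code : ('M[R[i]]_(m, n) -> 'M[R[i]]_(p, q)) ->
     {ffun 'I_r * ('I_p * 'I_q * bool) -> 'I_(2 * M).+1},
  forall h h', linear h -> linear h' ->
    (forall x, X x -> frob (h x) <= B) -> (forall x, X x -> frob (h' x) <= B) ->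
    code h = code h' -> forall x, X x ->
    frob (h x - h' x) <= r%:R * (2 * (Num.sqrt (2 * p * q)%:R * (B / M%:R))).
Proof.
have Xvec x : (mxvec @` X) x -> forall j, normc (x 0 j) <= bx.
  move=> [y Xy <-] j; case/mxvec_indexP: j => i j; rewrite mxvecE.
  by apply: le_trans (normc_le_frob _ _ _) _; exact: Xbounded.
have [r [A [rmn XA spanA]]] := exists_spanner Xvec.
exists r => // M M0; pose y i : 'M[R[i]]_(m, n) := vec_mx (row i A).
have Xy i : X (y i) by have [x Xx] := XA i; rewrite /y => <-; rewrite mxvecK.
pose part (b : bool) : R[i] -> R := if b then @complex.Re R else @complex.Im R.
exists (fun h => [ffun e => round_code B M (part e.2.2 (h (y e.1) e.2.1.1 e.2.1.2))]).
move=> h h' hlin h'lin hB h'B /ffunP ch x Xx.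
have yP i : frob (h (y i) - h' (y i)) <= Num.sqrt (2 * p * q)%:R * (B / M%:R).
  apply: frob_le_parts => [|j k]; first by rewrite divr_ge0// ltW.
  have part_close b : `|part b (h (y i) j k) - part b (h' (y i) j k)| <= B / M%:R.
    have part_le z : `|part b z| <= normc z.
      by case: b; [exact: abs_Re_le_normc|exact: abs_Im_le_normc].
    apply: eq_round_code => //.
    - by apply: le_trans (part_le _) (le_trans (normc_le_frob _ _ _) (hB _ (Xy i))).
    - by apply: le_trans (part_le _) (le_trans (normc_le_frob _ _ _) (h'B _ (Xy i))).
    - by have := ch (i, (j, k, b)); rewrite !ffunE.
  rewrite !mxE; have := part_close true; have := part_close false.
  by case: (h _ _ _) => a b; case: (h' _ _ _) => a' b'.
have [c xc cle] := spanA (mxvec x) (ex_intro2 _ _ x Xx erefl).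
have xE : x = \sum_i c 0 i *: y i.
  rewrite -[x]mxvecK xc mulmx_sum_row linear_sum; apply: eq_bigr => i _.
  by rewrite linearZ.
have sum_lin g : linear g -> g (\sum_i c 0 i *: y i) =
    \sum_i c 0 i *: g (y i) :> 'M[R[i]]_(p, q).
  move=> glin; pose gl : {linear _ -> _} :=
    HB.pack g (GRing.isLinear.Build _ _ _ _ g glin).
  rewrite -[LHS]/(gl _) (linear_sum gl); apply: eq_bigr => i _.
  exact: (linearZZ gl).
have -> : h x - h' x = \sum_i c 0 i *: (h (y i) - h' (y i)).
  rewrite xE (sum_lin _ hlin) (sum_lin _ h'lin) -sumrB.
  by apply: eq_bigr => i _; rewrite scalerBr.
(* There are [r] terms, each with a coefficient of modulus at most 2. *)
apply: le_trans (frob_sum _ _) _.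
rewrite mulr_natl -[X in _ *+ X]card_ord -sumr_const; apply: ler_sum => i _.
by rewrite frobZ ler_pM ?normc_ge0 ?frob_ge0.
Qed.
End Nets.

(** * The network and its loss *)

Section NetworkLinear.
Variables (R : realType) (n nrho : nat).
Implicit Types (omega : R) (K : 'M[R[i]]_(n, nrho)) (D A B : 'M[R[i]]_n) (a : R[i]).

Let mulmx_linear m p q r (M : 'M[R[i]]_(m, p)) (N : 'M[R[i]]_(q, r)) a
    (A B : 'M[R[i]]_(p, q)) :
  M *m (a *: A + B) *m N = a *: (M *m A *m N) + M *m B *m N.
Proof. by rewrite mulmxDr mulmxDl -scalemxAr -scalemxAl. Qed.

Lemma diagrow_linear m : linear (@diagrow R m).
Proof. by move=> a A B; apply/matrixP => i j; rewrite !mxE. Qed.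

Lemma rotmx_linear m : linear (@rotmx R n m).
Proof. by move=> a A B; apply/matrixP => i j; rewrite !mxE. Qed.

(** Conjugation only hits [K] and [D], never the argument, so the map is linear over the complex
    numbers. *)
Lemma phi1_linear K D omega : linear (phi1 K D omega).
Proof.
move=> a A B; rewrite /phi1 scalerA (mulrC a) -scalerA -scalerDr -diagrow_linear.
congr (_ *: diagrow _); rewrite -mulmx_linear !(mulmx_linear _ _ a A B).
by rewrite scalerDr addrACA.
Qed.

Lemma phi2_linear K omega : linear (phi2 K omega).
Proof.
move=> a A B; rewrite /phi2; move: (_ * c_omega _) => c.
rewrite scalerA (mulrC a) -scalerA -scalerDr -diagrow_linear.
by congr (_ *: diagrow _); rewrite mulmx_linear.
Qed.

Lemma phi1_rot_linear m K D omega : linear (fun A => phi1 K D omega (rotmx m A)).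
Proof. by move=> a A B; rewrite rotmx_linear phi1_linear. Qed.

Lemma phi2_rot_linear m K omega : linear (fun A => phi2 K omega (rotmx m A)).
Proof. by move=> a A B; rewrite rotmx_linear phi2_linear. Qed.

Lemma rows_linear m p (f : 'I_m -> 'M[R[i]]_n -> 'rV[R[i]]_p) :
  (forall k, linear (f k)) -> linear (fun A => \matrix_(k < m) f k A).
Proof.
move=> flin a A B; apply/row_matrixP => k.
by rewrite linearD linearZ/= !rowK flin.
Qed.

Lemma addmulmx_linear m p q r (Q1 Q2 : 'M[R[i]]_(m, p)) (Q : 'M[R[i]]_(q, r))
    (f1 f2 : 'M[R[i]]_n -> 'M[R[i]]_(p, q)) : linear f1 -> linear f2 ->
  linear (fun A => Q1 *m f1 A *m Q + Q2 *m f2 A *m Q).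
Proof.
move=> lin1 lin2 a A B.
by rewrite lin1 lin2 !mulmx_linear scalerDr addrACA.
Qed.

Lemma phi0_freq_linear (omega1 : R) K D omega :
  linear (phi0_freq omega1 K D omega).
Proof.
apply: addmulmx_linear.
  exact: (rows_linear (fun m : 'I_n => phi1_rot_linear m.+1 K D omega)).
exact: (rows_linear (fun m : 'I_n => phi2_rot_linear m.+1 K omega)).
Qed.

Lemma phi0_linear (omega1 omega2 : R) K D : linear (phi0 omega1 omega2 K D).
Proof.
have lin1 := phi0_freq_linear omega1 K D omega1.
have lin2 := phi0_freq_linear omega1 K D omega2.
rewrite /phi0; move: (phi0_freq _ _ _ _) (phi0_freq _ _ _ _) lin1 lin2.
move=> f1 f2 lin1 lin2 a A B.
by rewrite !linearP lin1 lin2 scalerDr addrACA.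
Qed.

Lemma H0_BFNN_linear (omega1 omega2 B_K B_D : R)
    (phi : 'M[R[i]]_(n + n, n) -> 'M[R[i]]_(n + n, n)) :
  H0_BFNN omega1 omega2 nrho B_K B_D phi -> linear phi.
Proof. by move=> [K [D [_ _ ->]]]; exact: phi0_linear. Qed.

Lemma H0_linear (omega1 omega2 alpha B_K B_D : R)
    (h : 'M[R[i]]_(n + n, n) -> 'M[R[i]]_(n + n, n)) :
  H0 omega1 omega2 nrho alpha B_K B_D h -> linear h.
Proof.
move=> [psi [psi0 [phi [_ _ /H0_BFNN_linear phil ->]]]] a A B.
by rewrite /= phil !linearP.
Qed.

(** The operator norms of [psi] and [psi0] contribute [2 / alpha] and [2]; this is how [alpha]
    enters the final bound. *)
Lemma H0_frob_le (omega1 omega2 alpha B_K B_D b : R)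
    (h : 'M[R[i]]_(n + n, n) -> 'M[R[i]]_(n + n, n)) (x : 'M[R[i]]_(n + n, n)) :
  0 < alpha ->
  (forall phi, H0_BFNN omega1 omega2 nrho B_K B_D phi -> frob (phi x) <= b) ->
  H0 omega1 omega2 nrho alpha B_K B_D h -> frob (h x) <= 4 * alpha^-1 * b.
Proof.
move=> alpha0 xb [psi [psi0 [phi [psile psi0le phiH ->]]]] /=.
apply: le_trans (frob_le_opnorm _ _) _.
have -> : 4 * alpha^-1 * b = (2 * alpha^-1) * (2 * b) by ring.
have b0 : 0 <= 2 * b.
  by rewrite mulr_ge0// (le_trans (frob_ge0 _) (xb _ phiH)).
apply: (@le_trans _ _ ((2 * alpha^-1) * frob (psi0 (phi x)))).
  by rewrite ler_wpM2r ?frob_ge0.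
apply: ler_wpM2l; first by rewrite mulr_ge0// invr_ge0 ltW.
apply: le_trans (frob_le_opnorm _ _) _.
by apply: (@le_trans _ _ (2 * frob (phi x)));
  rewrite ?ler_wpM2r ?ler_wpM2l ?frob_ge0 ?xb.
Qed.

End NetworkLinear.

Section LossMeasurable.
Variables (R : realType) (n : nat).
Implicit Type h : 'M[R[i]]_(n + n, n) -> 'M[R[i]]_(n + n, n).

Lemma measurable_Re_entry m p i j :
  measurable_fun setT (fun A : cmx_meas R m p => complex.Re (A i j)).
Proof.
move=> _ B mB; rewrite setTI; apply: sub_sigma_algebra.
by exists i, j, B => //; left.
Qed.

Lemma measurable_Im_entry m p i j :
  measurable_fun setT (fun A : cmx_meas R m p => complex.Im (A i j)).
Proof.
move=> _ B mB; rewrite setTI; apply: sub_sigma_algebra.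
by exists i, j, B => //; right.
Qed.

Lemma measurable_rmx_entry m p i j :
  measurable_fun setT (fun A : rmx_meas R m p => (A i j : R)).
Proof.
by move=> _ B mB; rewrite setTI; apply: sub_sigma_algebra; exists i, j, B.
Qed.

(** The sigma-algebra is generated by the parts of the entries, and the parts of [h A i j] are real
    linear combinations of these. *)
Lemma linear_parts_measurable h i j : linear h ->
  measurable_fun setT (fun A : cmx_meas R (n + n) n => complex.Re (h A i j)) /\
  measurable_fun setT (fun A : cmx_meas R (n + n) n => complex.Im (h A i j)).
Proof.
move=> hlin; pose hl : {linear _ -> _} := HB.pack h (GRing.isLinear.Build _ _ _ _ h hlin).
have hE A : h A i j = \sum_k \sum_l A k l * h (delta_mx k l) i j.
  rewrite [in LHS](matrix_sum_delta A) -[h in LHS]/(hl : _ -> _) linear_sum summxE.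
  apply: eq_bigr => k _; rewrite linear_sum summxE; apply: eq_bigr => l _.
  by rewrite linearZ mxE.
pose u k l := h (delta_mx k l) i j.
have ReE A : complex.Re (h A i j) = \sum_k \sum_l
    (complex.Re (A k l) * complex.Re (u k l) - complex.Im (A k l) * complex.Im (u k l)).
  rewrite hE raddf_sum; apply: eq_bigr => k _; rewrite raddf_sum.
  by apply: eq_bigr => l _ /=; rewrite -/(u k l); case: (A k l); case: (u k l).
have ImE A : complex.Im (h A i j) = \sum_k \sum_l
    (complex.Re (A k l) * complex.Im (u k l) + complex.Im (A k l) * complex.Re (u k l)).
  rewrite hE raddf_sum; apply: eq_bigr => k _; rewrite raddf_sum.
  by apply: eq_bigr => l _ /=; rewrite -/(u k l); case: (A k l); case: (u k l).
split.
  under eq_fun do rewrite ReE.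
  apply: measurable_sum => k; apply: measurable_sum => l; apply: measurable_funB.
    by apply: measurable_funM; [exact: measurable_Re_entry|exact: measurable_cst].
  by apply: measurable_funM; [exact: measurable_Im_entry|exact: measurable_cst].
under eq_fun do rewrite ImE.
apply: measurable_sum => k; apply: measurable_sum => l; apply: measurable_funD.
  by apply: measurable_funM; [exact: measurable_Re_entry|exact: measurable_cst].
by apply: measurable_funM; [exact: measurable_Im_entry|exact: measurable_cst].
Qed.

Lemma measurable_loss h : linear h ->
  measurable_fun setT (loss h : data R n -> R).
Proof.
move=> hlin.
have -> : loss h = fun z : data R n => Num.sqrt (\sum_i \sum_j
    ((complex.Re (h z.1 i j) - z.2 i j) ^+ 2 + complex.Im (h z.1 i j) ^+ 2)).
  apply/funext => z; congr Num.sqrt; apply: eq_bigr => i _; apply: eq_bigr => j _.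
  by rewrite sqr_normc !mxE; case: (h _ _ _) => a b /=; rewrite subr0.
apply: (measurableT_comp (continuous_measurable_fun (@sqrt_continuous R))).
apply: measurable_sum => i; apply: measurable_sum => j.
have [mRe mIm] := linear_parts_measurable i j hlin.
apply: measurable_funD; apply: measurable_funX; last exact: measurableT_comp mIm _.
apply: measurable_funB; first exact: measurableT_comp mRe _.
exact: measurableT_comp (measurable_rmx_entry i j) _.
Qed.

(** Reverse triangle inequality, the target cancelling. It turns nets of maps into nets of
    losses. *)
Lemma loss_lipschitz h h' (z : data R n) :
  `|loss h z - loss h' z| <= frob (h z.1 - h' z.1).
Proof.
have tri (A B : 'M[R[i]]_(n + n, n)) : frob A - frob B <= frob (A - B).
  by rewrite lerBlDl; have := frobD B (A - B); rewrite addrC subrK.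
rewrite /loss; set y := complexmx _.
have AB : h z.1 - y - (h' z.1 - y) = h z.1 - h' z.1 by rewrite opprB addrA subrK.
have := tri (h z.1 - y) (h' z.1 - y); rewrite AB.
have := tri (h' z.1 - y) (h z.1 - y); rewrite -[leRHS]frobN opprB AB.
by rewrite ler_norml; lra.
Qed.

End LossMeasurable.

(** * Uniform deviation over bounded linear maps *)

Lemma sqrt_addr_sqr_le (R : rcfType) (a b : R) : 0 <= a -> 0 <= b ->
  Num.sqrt (a + b ^+ 2) <= Num.sqrt a + b.
Proof.
move=> a0 b0; have s0 := sqrtr_ge0 a.
rewrite -(ger0_norm (addr_ge0 s0 b0)) -sqrtr_sqr ler_wsqrtr//.
by rewrite sqrrD sqr_sqrtr// -addrA lerD2l lerDr mulrn_wge0// mulr_ge0.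
Qed.

Lemma ln_nat_le_exponent (R : realType) (m e : nat) :
  (0 < m)%N -> (m <= 2 ^ e)%N -> ln (m%:R : R) <= e%:R.
Proof.
move=> m0 me; apply: (@le_trans _ _ (ln ((2 ^ e)%:R : R))).
  by rewrite ler_ln ?posrE ?ltr0n ?expn_gt0// ler_nat.
rewrite natrX lnXn// -(mulr_natl (ln _)) ler_piMr//.
by apply: (@le_ln1Dx R 1); lra.
Qed.

(** Closed form of an arithmetic-geometric sum: over [k >= 1], the series of [8 ^ - k] is [1 / 7]
    and that of [(11 + 3 k) 8 ^ - k] is [101 / 49]. *)
Lemma sum_chaining_weights (R : realFieldType) (K : nat) (s c : R) :
  \sum_(k < K) (s + c * (11 + 3 * k.+1%:R)) / 8 ^+ k.+1 =
  s / 7 + c * (101 / 49) - (s / 7 + c * (101 / 49 + 3 / 7 * K%:R)) / 8 ^+ K.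
Proof.
elim: K => [|K IH]; first by rewrite big_ord0 expr0; field.
rewrite big_ord_recr/= IH -!natr1 exprS; field.
by rewrite expf_neq0.
Qed.
(** Cutting off outside [Z] makes bounds that hold almost everywhere hold everywhere, as [chaining]
    requires. *)
Definition truncated_loss (R : realType) n (Z : set (data R n))
    (h : 'M[R[i]]_(n + n, n) -> 'M[R[i]]_(n + n, n)) (z : data R n) : R :=
  loss h z * \1_Z z.

Section UniformDeviation.
Context d (Omega : measurableType d) (R : realType) (P : probability Omega R).
Context (n N : nat) (mu : {measure set (data R n) -> \bar R}).
Context (S : 'I_N -> {RV P >-> data R n}).
Hypotheses (n0 : (0 < n)%N) (N0 : (0 < N)%N) (iidS : iid_with_law mu S).
Variables (X0 : set 'M[R[i]]_(n + n, n)) (Z : set (data R n)) (bx b B delta : R).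
Hypotheses (X0_bounded : forall x, X0 x -> frob x <= bx).
Hypotheses (mZ : measurable Z) (ZX0 : forall z, Z z -> X0 z.1)
  (Zb : forall z, Z z -> frob (complexmx z.2) <= b).
Hypotheses (b0 : 0 < b) (B0 : 0 < B) (delta01 : 0 < delta < 1).
Local Notation fn := ('M[R[i]]_(n + n, n) -> 'M[R[i]]_(n + n, n)).

Let G : set fn := [set h | linear h /\ forall x, X0 x -> frob (h x) <= B].

Let l := truncated_loss Z.

Let h0 : fn := fun=> 0.

Let Gh0 : G h0.
Proof.
split; first by move=> a A A'; rewrite /h0 scaler0 addr0.
by move=> x _; rewrite frob0 ltW.
Qed.

Let ml h : G h -> measurable_fun setT (l h).
Proof.
move=> [hlin _]; apply: measurable_funM; first exact: measurable_loss.
exact: measurable_indic.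
Qed.

Let l_lipschitz h h' e : 0 <= e -> (forall x, X0 x -> frob (h x - h' x) <= e) ->
  forall z, `|l h z - l h' z| <= e.
Proof.
move=> e0 hh' z; rewrite /l /truncated_loss -mulrBl indicE.
have [Zz|nZz] := boolP (z \in Z); last by rewrite mulr0 normr0.
rewrite mulr1; apply: le_trans (loss_lipschitz _ _ _) _; apply/hh'/ZX0.
exact/set_mem.
Qed.

Let l_h0 z : 0 <= l h0 z <= b.
Proof.
rewrite /l /truncated_loss /loss /h0 sub0r frobN indicE.
have [Zz|nZz] := boolP (z \in Z); last by rewrite mulr0 lexx ltW.
by rewrite mulr1 frob_ge0 Zb//; exact/set_mem.
Qed.

Let l_h0_close h : G h -> forall z, `|l h z - l h0 z| <= B.
Proof.
by move=> [_ hB]; apply: l_lipschitz (ltW B0) _ => x Xx; rewrite subr0 hB.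
Qed.

Let l_bounded h : G h -> exists c, forall z, `|l h z| <= c.
Proof.
move=> Gh; exists (B + b) => z.
have := l_h0_close Gh z; have := l_h0 z; rewrite !ler_norml; lra.
Qed.

(* This number of cells makes the rounding error of [linear_net], for [r]
   at most [2 * n ^ 2], equal to [B / 8 ^ k]. *)
Let M k : nat := (8 * n ^ 3 * 8 ^ k)%N.

Let M0 k : (0 < M k)%N.
Proof. by rewrite !muln_gt0 !expn_gt0 n0. Qed.

(** From [n ^ 3 < 2 ^ (3 n)]: rounding one real number costs a number of bits linear in [n + k]. *)
Let M_le_exponent k : ((2 * M k).+1 <= 2 ^ (4 + 3 * k + 3 * n))%N.
Proof.
have n3 : (n ^ 3 < 2 ^ (3 * n))%N by rewrite mulnC expnM ltn_exp2r// ltn_expl.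
have -> : (2 ^ (4 + 3 * k + 3 * n) = 16 * 8 ^ k * 2 ^ (3 * n))%N.
  by rewrite expnD expnD (expnM 2 3 k).
rewrite /M; have : (0 < 8 ^ k)%N by rewrite expn_gt0.
move: n3; set u := (_ ^ 3)%N; set v := (2 ^ _)%N.
set w := (8 ^ k)%N => uv w0.
apply: (@leq_trans (16 * w * u.+1)); last by rewrite leq_mul2l uv orbT.
have -> : (2 * (8 * u * w) = 16 * w * u)%N.
  by rewrite -[RHS]mulnA (mulnC w) -mulnA mulnA.
by rewrite mulnS -addn1 addnC leq_add2r muln_gt0.
Qed.

Let eps k : R := B / 8 ^+ k.

Let rN : R := (Num.sqrt N%:R)^-1.
Let s : R := Num.sqrt (ln (4 * delta^-1)).

Let ln4d0 : 0 <= ln (4 * delta^-1).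
Proof.
apply: ln_ge0; rewrite ler_pdivlMr; last by case/andP: delta01.
by case/andP: delta01; lra.
Qed.

(** [chaining] with the nets of [linear_net] at scales [B / 8 ^ k]. A link contributes [4 (eps k +
    eps k.+1) = 36 B / 8 ^ (k + 1)]; summation gives [36 / 7], and [36 * 101 / 49 <= 75]. *)
Lemma truncated_loss_uniform_deviation : exists E : set Omega, [/\ measurable E,
  ((1 - delta)%:E <= P E)%E & forall w, E w -> forall h, linear h ->
    (forall x, X0 x -> frob (h x) <= B) ->
    (\int[mu]_z (truncated_loss Z h z)%:E <=
     (sample_mean S (truncated_loss Z h) w +
      (2 * b * s + 36 / 7 * B * s + 75 * n%:R ^+ 3 * B) * rN)%:E)%E].
Proof.
have [r rn net] := linear_net (n + n) n X0_bounded B0.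
pose F k : finType := {ffun 'I_r * ('I_(n + n) * 'I_n * bool) -> 'I_(2 * M k).+1}.
pose code k : fn -> F k := sval (cid (net (M k) (M0 k))).
have codeP k := svalP (cid (net (M k) (M0 k))).
(* The chain must start at [h0], whence the special level 0; at other levels [h0] is also the
   default for codes that no map in [G] has. *)
pose rep k (c : F k) : fn :=
  if k == 0%N then h0 else xget h0 [set h | G h /\ code k h = c].
have Grep k c : G (rep k c).
  by rewrite /rep; case: eqP => // _; case: xgetP => // h _ [].
have n0R : (0 : R) < n%:R by rewrite ltr0n.
have eps_gt0 k : 0 < eps k by rewrite divr_gt0// exprn_gt0.
have repP k h : G h -> forall z, `|l h z - l (rep k (code k h)) z| <= eps k.
  move=> Gh; have [-> z|k0] := eqVneq k 0%N.
    by rewrite /rep/= /eps expr0 divr1; exact: l_h0_close.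
  rewrite /rep (negbTE k0); case: xgetP => [h' _ [Gh' hh']|/(_ h)[]//].
  apply: l_lipschitz (ltW (eps_gt0 k)) _ => x Xx.
  have [[hlin hB] [h'lin h'B]] := (Gh, Gh').
  apply: le_trans (codeP k h h' hlin h'lin hB h'B (esym hh') x Xx) _.
  have -> : ((2 * (n + n) * n)%:R : R) = (2 * n%:R) ^+ 2.
    by rewrite !natrM natrD; ring.
  rewrite sqrtr_sqr ger0_norm; last by rewrite mulr_ge0// ltW.
  have -> : eps k = ((n + n) * n)%:R * (2 * (2 * n%:R * (B / (M k)%:R))).
    rewrite /eps /M !natrM natrD !natrX; field.
    by rewrite expf_neq0//= gt_eqF.
  rewrite ler_wpM2r ?ler_nat//.
  by do 2?apply: mulr_ge0; rewrite ?mulr_ge0 ?divr_ge0 ?(ltW n0R) ?(ltW B0).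
pose cardF k : R := #|F k|%:R.
have cardF_ge1 k : (0 < #|F k|)%N by rewrite card_ffun expn_gt0 card_ord.
(* A code has [r * 4 n ^ 2 <= 8 n ^ 4] real entries: real and imaginary parts of [2 n ^ 2] entries
   for each of the [r] spanning inputs. *)
have ln_cardF k : 0 <= ln (cardF k) <= 8 * n%:R ^+ 4 * (4 + 3 * k%:R + 3 * n%:R).
  rewrite ln_ge0 ?ler1n//= /cardF card_ffun !card_prod !card_ord card_bool.
  rewrite natrX lnXn ?ltr0n// -(mulr_natl (ln _)).
  have e1 : ln ((2 * M k).+1%:R : R) <= 4 + 3 * k%:R + 3 * n%:R.
    by apply: le_trans (ln_nat_le_exponent R _ (M_le_exponent k)) _;
      rewrite // natrD natrD natrM natrM.
  apply: ler_pM => //; first by rewrite ln_ge0// ler1n.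
  have -> : 8 * n%:R ^+ 4 = ((n + n) * n * ((n + n) * n * 2))%:R :> R.
    by rewrite !natrM natrD; ring.
  by rewrite ler_nat leq_mul2r rn orbT.
(* The last terms pay for the union bound over the links between two levels. *)
pose lam k : R := ln (4 * delta^-1) +
  (if k is j.+1 then ln (cardF j) + ln (cardF j.+1) + j%:R * ln 2 else 0).
have ln2_ge0 : 0 <= ln (2 : R) by apply: ln_ge0; lra.
have lam_ge0 k : 0 <= lam k.
  rewrite /lam addr_ge0//; case: k => // k; rewrite !addr_ge0 ?mulr_ge0//.
    by case/andP: (ln_cardF k).
  by case/andP: (ln_cardF k.+1).
(* The powers [n ^ 4] and [n ^ 5] are raised to [n ^ 6] to reach a perfect square, so that the
   square root of [lam] splits into [s] plus a term of order [n ^ 3]. *)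
have lam_le k : lam k.+1 <= ln (4 * delta^-1) + (n%:R ^+ 3 * (11 + 3 * k.+1%:R)) ^+ 2.
  have /andP[_ c1] := ln_cardF k; have /andP[_ c2] := ln_cardF k.+1.
  have k_ge0 : (0 : R) <= k%:R by [].
  have n_ge1 : (1 : R) <= n%:R by rewrite ler1n.
  have ln2_le1 : ln (2 : R) <= 1 by apply: (@le_ln1Dx R 1); lra.
  have kln2 : k%:R * ln (2 : R) <= k%:R by rewrite ler_piMr.
  have n4 : (1 : R) <= n%:R ^+ 4 by rewrite exprn_ege1.
  have n6 : n%:R ^+ 4 <= n%:R ^+ 6 :> R by rewrite ler_weXn2l.
  have n5 : n%:R ^+ 5 <= n%:R ^+ 6 :> R by rewrite ler_weXn2l.
  rewrite /lam lerD2l exprMn -exprM -[(3 * 2)%N]/6%N.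
  move: c1 c2; rewrite -(natr1 k); move: n4 n5 n6.
  rewrite (exprS _ 4); set u : R := _ ^+ 4; set v : R := _ ^+ 6.
  move=> u1 uv' uv c1 c2.
  have ku : k%:R * u <= k%:R * v by rewrite ler_wpM2l.
  have kv : k%:R <= k%:R * v by rewrite ler_peMr// (le_trans u1).
  have kkv : 0 <= v * k%:R ^+ 2 by rewrite mulr_ge0 ?sqr_ge0//; lra.
  lra.
have [d0 d1] := andP delta01.
have d4 : 0 < 4 * delta^-1 by rewrite mulr_gt0// invr_gt0.
have lam0_delta : expR (- lam 0%N) <= delta / (2 ^ 1)%:R.
  by rewrite /lam addr0 expRN lnK ?posrE// invfM invrK expn1; lra.
(* An equality: the logarithms in [lam k.+1] cancel the cardinalities and leave
   [delta / 4 / 2 ^ k]. *)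
have lam_delta k : cardF k * cardF k.+1 * expR (- lam k.+1) <=
    delta / (2 ^ k.+2)%:R.
  rewrite /lam expRN !expRD expRM_natl !lnK ?posrE ?ltr0n//.
  rewrite natrX exprS exprS le_eqVlt; apply/orP; left; apply/eqP; field.
  by rewrite ?expf_neq0 ?gt_eqF ?ltr0n//.
have N0R : (0 : R) < Num.sqrt N%:R by rewrite sqrtr_gt0 ltr0n.
have rN0 : 0 <= rN by rewrite invr_ge0 ltW.
have sqrtN x : 0 <= x -> Num.sqrt (x / N%:R) = Num.sqrt x * rN.
  by move=> x0; rewrite sqrtrM// sqrtrV.
have s0 : 0 <= s by exact: sqrtr_ge0.
have W_ge K : 2 * b * Num.sqrt (lam 0%N / N%:R) + \sum_(k < K)
     2 * (2 * (eps k + eps k.+1)) * Num.sqrt (lam k.+1 / N%:R) <=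
    (2 * b * s + 36 / 7 * B * s + 75 * n%:R ^+ 3 * B) * rN.
  apply: (@le_trans _ _ (2 * b * s * rN + 36 * B * rN *
      \sum_(k < K) (s + n%:R ^+ 3 * (11 + 3 * k.+1%:R)) / 8 ^+ k.+1)).
    apply: lerD; first by rewrite sqrtN// /lam addr0 mulrA.
    rewrite mulr_sumr; apply: ler_sum => k _; rewrite sqrtN//.
    have sq : Num.sqrt (lam k.+1) <= s + n%:R ^+ 3 * (11 + 3 * k.+1%:R).
      by apply: le_trans (ler_wsqrtr (lam_le k)) _; exact: sqrt_addr_sqr_le.
    have -> : 2 * (2 * (eps k + eps k.+1)) = 36 * B / 8 ^+ k.+1.
      by rewrite /eps exprS; field; rewrite expf_neq0.
    have -> : 36 * B * rN * ((s + n%:R ^+ 3 * (11 + 3 * k.+1%:R)) / 8 ^+ k.+1) =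
      36 * B / 8 ^+ k.+1 * ((s + n%:R ^+ 3 * (11 + 3 * k.+1%:R)) * rN) by ring.
    apply: ler_wpM2l; last by rewrite ler_wpM2r.
    by rewrite divr_ge0 ?exprn_ge0// mulr_ge0// ltW.
  (* [q] is the nonnegative remainder of the series; dropping it makes the bound independent of
     [K]. *)
  rewrite sum_chaining_weights; set q := (_ / 8 ^+ K).
  have q0 : 0 <= q.
    apply: divr_ge0; last exact: exprn_ge0.
    by rewrite addr_ge0 ?divr_ge0 ?mulr_ge0 ?exprn_ge0 ?addr_ge0 ?divr_ge0 ?mulr_ge0.
  have n3 : 0 <= n%:R ^+ 3 * B * rN.
    by rewrite mulr_ge0// mulr_ge0 ?exprn_ge0// ltW.
  have q1 : 0 <= B * rN * q by rewrite mulr_ge0// mulr_ge0// ltW.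
  lra.
have eps_small e : 0 < e -> exists K, eps K <= e.
  move=> e0; exists (Num.truncn (B / e)).+1; set K := _.+1.
  have BK : B / e < K%:R.
    by have /andP[] := truncn_itv (ltW (divr_gt0 B0 e0)).
  rewrite /eps ler_pdivrMr ?exprn_gt0// mulrC -ler_pdivrMr//.
  apply: le_trans (ltW BK) _; rewrite -natrX ler_nat ltnW//.
  exact: ltn_expl.
have [E [mE PE devE]] := @chaining _ _ _ _ _ P mu N S (0, 0) N0 iidS fn G G l h0
  F code rep b delta _ eps lam ml l_bounded (@subset_refl _ _) Gh0 Grep
  (fun=> erefl) b0 l_h0 repP eps_gt0 lam_ge0 (ltW d0) lam0_delta lam_delta
  W_ge eps_small.
by exists E; split=> // w Ew h hlin hB; exact: devE.
Qed.

End UniformDeviation.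

(** * From truncated losses to the generalization bound *)

Theorem theorem4p1 (R : realType)
    (omega1 omega2 alpha B_in B_tgt B_out B_K B_D : R)
    (n_c n_rho N : nat)
    (d : measure_display) (Omega : measurableType d) (P : probability Omega R)
    (mu1 : probability (cmx_meas R (n_c + n_c) n_c) R)
    (mu2 : probability (rmx_meas R (n_c + n_c) n_c) R)
    (S : 'I_N -> {RV P >-> data R n_c})
    (homega : 0 < omega1 < omega2)
    (hratio : omega2 / omega1 \is a Num.nat)
    (halpha : 0 < alpha)
    (hn_c : (0 < n_c)%N) (hn_rho : (0 < n_rho)%N)
    (hn : n_c%:R = omega1 / omega2 * n_rho%:R)
    (hB_in : 0 < B_in) (hB_tgt : 0 < B_tgt) (hB_out : 0 < B_out)
    (hB_K : 0 < B_K) (hB_D : 0 < B_D)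
    (hN : (0 < N)%N)
    (hS : iid_with_law (mu1 \x mu2)%E S)
    (hin : {ae mu1, forall Lambda, frob Lambda <= B_in})
    (htgt : {ae mu2, forall Y, frob (complexmx Y) <= B_tgt})
    (hreal : {ae mu1, forall Lambda, forall phi,
       H0_BFNN omega1 omega2 n_rho B_K B_D phi -> phi Lambda \is a realmx})
    (hout : {ae mu1, forall Lambda, forall h,
       H0 omega1 omega2 n_rho alpha B_K B_D h -> frob (h Lambda) <= B_out})
    (hout0 : {ae mu1, forall Lambda, forall phi,
       H0_BFNN omega1 omega2 n_rho B_K B_D phi -> frob (phi Lambda) <= B_out}) :
  let c0 : R := 2 ^+ 5 * pi ^+ 2 *
    (Normc.normc (c_omega omega1) + Normc.normc (c_omega omega2)) *
    Num.sqrt (B_D ^+ 4 + 1) * B_K ^+ 2 * B_in in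
  forall delta : R, 0 < delta < 1 ->
  exists E : set Omega, [/\ measurable E, ((1 - delta)%:E <= P E)%E &
    forall w, E w -> forall h, H0 omega1 omega2 n_rho alpha B_K B_D h ->
      (true_risk (mu1 \x mu2) h <=
       (empirical_risk h (fun s => S s w) +
        2 ^+ 2 *
        (Num.sqrt (2 * ln (4 * delta^-1)) * (B_out + B_tgt) +
         2 ^+ 6 * 3 * Num.sqrt (omega2 / omega1) * B_out * alpha^-1 *
         Num.sqrt (1 + c0 * B_out^-1 * (n_c%:R `^ (- (3 / 2)))) *
         n_c%:R ^+ 3) *
        (N%:R `^ (- (1 / 2))))%:E)%E].
Proof.
move=> c0 delta d01; have [w10 w12] := andP homega.
(* [B <= B_out] will serve in the term with [delta], and [B <= 4 B_out / alpha] in the term with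
   [n_c ^ 3]. *)
pose B := Num.min B_out (4 * alpha^-1 * B_out).
have B0 : 0 < B by rewrite lt_min hB_out/= !mulr_gt0 ?invr_gt0.
pose X0 : set 'M[R[i]]_(n_c + n_c, n_c) := [set x | [/\ frob x <= B_in,
  forall h, H0 omega1 omega2 n_rho alpha B_K B_D h -> frob (h x) <= B_out &
  forall phi, H0_BFNN omega1 omega2 n_rho B_K B_D phi -> frob (phi x) <= B_out]].
have [A1 [mA1 A10 sub1]] : mu1.-negligible (~` X0).
  apply: negligibleS (negligibleU (negligibleU hin hout) hout0) => x nX.
  apply: contrapT => nx; apply: nX; split; apply: contrapT => nP; apply: nx.
  - by left; left.
  - by left; right.
  - by right.
have [A2 [mA2 A20 sub2]] := htgt.
(* [A1] and [A2] are measurable null sets containing the exceptional inputs and targets, so [Z] is a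
   measurable rectangle of full mass even if [X0] itself is not known to be measurable. *)
pose Z : set (data R n_c) := (~` A1) `*` (~` A2).
have mZ : measurable Z by apply: measurableX; exact: measurableC.
have muZ : (mu1 \x mu2)%E Z = 1%E.
  have E1 : mu1 (~` A1) = 1%E by rewrite probability_setC// A10 sube0.
  have E2 : mu2 (~` A2) = 1%E by rewrite probability_setC// A20 sube0.
  transitivity (mu1 (~` A1) * mu2 (~` A2))%E; last by rewrite E1 E2 mule1.
  by apply: product_measure1E; exact: measurableC.
have ZX0 z : Z z -> X0 z.1.
  by move=> [nA1 _]; apply: contrapT => nX; apply: nA1; exact: sub1.
have Zb z : Z z -> frob (complexmx z.2) <= B_tgt.
  by move=> [_ nA2]; apply: contrapT => nb; apply: nA2; exact: sub2.
have X0_bounded x : X0 x -> frob x <= B_in by case.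
have [E [mE PE devE]] := truncated_loss_uniform_deviation hn_c hN hS
  X0_bounded mZ ZX0 Zb hB_tgt B0 d01.
(* Almost surely the whole sample lies in [Z], where truncated and actual losses agree; intersecting
   [E] with [E'] costs no probability. *)
pose E' := [set w | forall s, Z (S s w)].
have mE' : measurable E'.
  apply: (measurable_forall_fin (F := fun s => S s @^-1` Z)) => s.
  exact: measurable_funPTI.
have PE' : P E' = 1%E.
  rewrite (hS.2 (fun=> Z))//; apply: big1 => s _.
  by rewrite hS.1.
exists (E `&` E'); split; first exact: measurableI.
  apply: le_trans PE _.
  apply: (@le_trans _ _ (P (E `&` E') + P (~` E'))%E); last first.
    by rewrite probability_setC// PE' subee// adde0.
  apply: le_trans (measureU2 _ _ _); [|exact: measurableI|exact: measurableC].
  apply: le_measure; rewrite ?inE//.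
    by apply: measurableU; [exact: measurableI|exact: measurableC].
  by move=> w Ew; have [?|?] := pselect (E' w); [left|right].
move=> w [Ew E'w] h Hh.
have hlin := H0_linear Hh.
have hB x : X0 x -> frob (h x) <= B.
  move=> [_ x1 x2]; rewrite le_min x1//=.
  exact: (H0_frob_le halpha x2 Hh).
(* Truncation changes the loss only outside [Z], hence not its integral. *)
have -> : true_risk (mu1 \x mu2)%E h =
    (\int[(mu1 \x mu2)%E]_z (truncated_loss Z h z)%:E)%E.
  have mh := measurable_loss hlin.
  apply: ge0_ae_eq_integral => //.
  - exact/measurable_EFinP.
  - by apply/measurable_EFinP/measurable_funM => //; exact: measurable_indic.
  - by move=> z _; rewrite lee_fin frob_ge0.
  - by move=> z _; rewrite lee_fin mulr_ge0 ?frob_ge0.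
  exists (~` Z); split; first exact: measurableC.
    transitivity (1 - (mu1 \x mu2)%E Z)%E; last by rewrite muZ subee.
    exact: probability_setC.
  move=> z nlz Zz; apply: nlz => _.
  by rewrite /truncated_loss indicE mem_set ?mulr1.
have -> : empirical_risk h (fun s => S s w) = sample_mean S (truncated_loss Z h) w.
  rewrite /empirical_risk /sample_mean; congr (_ * _); apply: eq_bigr => s _.
  by rewrite /truncated_loss indicE mem_set ?mulr1//; exact: E'w.
apply: le_trans (devE w Ew h hlin hB) _.
rewrite lee_fin lerD2l.
have -> : (N%:R : R) `^ (- (1 / 2)) = (Num.sqrt N%:R)^-1.
  by rewrite powRN div1r powR12_sqrt.
rewrite ler_wpM2r ?invr_ge0 ?sqrtr_ge0//.
set s := Num.sqrt (ln _); have s0 : 0 <= s by exact: sqrtr_ge0.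
rewrite sqrtrM// -/s; set s2 := Num.sqrt 2.
(* The coefficient [36 / 7] of [B * s] is [4 * (9 / 7)], to be absorbed by the factor [4 * sqrt 2]
   of the claim. *)
have s2_ge : 9 / 7 <= s2.
  have s20 : 0 <= s2 by exact: sqrtr_ge0.
  by have : s2 ^+ 2 = 2 by [rewrite sqr_sqrtr]; nra.
set q := Num.sqrt (omega2 / omega1).
have q_ge1 : 1 <= q.
  by rewrite -[leLHS]sqrtr1 ler_wsqrtr// ler_pdivlMr// mul1r ltW.
set y := Num.sqrt (1 + _).
have y_ge1 : 1 <= y.
  rewrite -[leLHS]sqrtr1 ler_wsqrtr// lerDl.
  rewrite mulr_ge0 ?powR_ge0// divr_ge0 ?(ltW hB_out)//.
  rewrite /c0 mulr_ge0 ?(ltW hB_in)// mulr_ge0 ?exprn_ge0 ?(ltW hB_K)//.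
  rewrite mulr_ge0 ?sqrtr_ge0// mulr_ge0 ?addr_ge0 ?normc_ge0//.
  by rewrite mulr_ge0 ?exprn_ge0 ?pi_ge0.
set m := n_c%:R ^+ 3; have m0 : 0 <= m by exact: exprn_ge0.
have Ble1 : B <= B_out by rewrite ge_min lexx.
have Ble2 : B <= 4 * (B_out * alpha^-1).
  by rewrite mulrA mulrAC ge_min lexx orbT.
set A := B_out * alpha^-1 in Ble2 *.
have A0 : 0 < A by rewrite mulr_gt0 ?invr_gt0.
have qy : 1 <= q * y by rewrite -[leLHS]mul1r ler_pM.
have mA : m * B <= 4 * (m * A) by rewrite mulrCA ler_wpM2l.
have mAqy : m * A <= (q * y) * (m * A) by rewrite ler_peMl// mulr_ge0// ltW.
have sB : s * B <= s * B_out by rewrite ler_wpM2l.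
have sBo : 9 / 7 * (s * (B_out + B_tgt)) <= s2 * (s * (B_out + B_tgt)).
  by rewrite ler_wpM2r// mulr_ge0// addr_ge0 ?ltW.
have sBt : 0 <= s * B_tgt by rewrite mulr_ge0// ltW.
have sBo0 : 0 <= s * B_out by rewrite mulr_ge0// ltW.
have mA0 : 0 <= m * A by rewrite mulr_ge0// ltW.
(* It remains to compare [75 m B <= 300 m A] with [4 * 192 * (q y m A)], where [q y >= 1]. *)
have -> : 2 ^+ 6 * 3 * q * B_out * alpha^-1 * y * m = 192 * (q * y * (m * A)).
  by rewrite /A; ring.
lra.
Qed.
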